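(* Let $P$ be a dynamic path with $|P|=n+1$ vertices (as in the context) and let $k$ be an integer with $1\le k\le n+1$. There is an algorithm running in $O(k|P|\log^2|P|)$ time that computes $\Theta^k(P)$ and also outputs a $k$-sink evacuation protocol for $P$ attaining it, i.e., a partition of $P$ into consecutive subpaths $Q_1,\dots,Q_k$ and sinks $y_j\in Q_j$ with $\Theta^k(P)=\max_{1\le j\le k}\Theta(Q_j,y_j)$.
   Context: A dynamic path $P$ consists of real points (vertices) $x_0<\dots<x_n$, edges $e_i=(x_{i-1},x_i)$, a constant $\tau>0$ (time to travel unit distance) with every $|x_i-x_j|\tau$ an integer, nonnegative integer weights $w_i$ (people at $x_i$) and positive integer capacities $c_i$ of $e_i$; $|P|=n+1$. For $a\le b$, $P_{a,b}$ is the dynamic subpath on vertices $x_a,\dots,x_b$ with the same data; $y\in P_{a,b}$ means $y\in[x_a,x_b]$. Discrete evacuation model on a path $Q$ with sink $y$: everyone moves toward $y$; time is discrete; at each vertex people wait in a FIFO queue to enter the next edge toward $y$; at each integer time step at most $c_i$ people may enter $e_i$, entering as soon as capacity and the queue permit; distance $d$ takes time $d\tau$; people starting at $y$ are evacuated at time $0$. $\Theta_L(Q,y)$ (resp. $\Theta_R(Q,y)$) is the time at which all people on vertices of $Q$ strictly left (resp. right) of $y$ have reached $y$, and $\Theta(Q,y)=\max(\Theta_L(Q,y),\Theta_R(Q,y))$. A $k$-sink evacuation protocol for $P$ is a choice of indices $0=i_0<i_1<\dots<i_k=n+1$, giving subpaths $Q_j=P_{i_{j-1},i_j-1}$, together with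 sinks $y_j\in Q_j$; its time is $\max_j\Theta(Q_j,y_j)$. $\Theta^k(P)$ is the minimum time over all $k$-sink evacuation protocols for $P$. *)

(* Defs.v *)
From Stdlib Require Import Reals ZArith Arith List.
Open Scope R_scope.

(** * Dynamic paths *)

(** Vertices are [0 .. nedges P]; edge [i] joins vertices [i - 1] and [i], for
    [1 <= i <= nedges P].  The values of the fields outside these ranges are
    irrelevant. *)
Record path : Type := Path {
  nedges : nat;
  vpos : nat -> R;
  tau : R;
  weight : nat -> nat;
  cap : nat -> nat }.

Definition is_dynamic_path (P : path) : Prop :=
  0 < tau P
  /\ (forall i, (i < nedges P)%nat -> vpos P i < vpos P (S i))
  /\ (forall i j, (i <= nedges P)%nat -> (j <= nedges P)%nat ->
        exists z : Z, Rabs (vpos P i - vpos P j) * tau P = IZR z)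
  /\ (forall i, (1 <= i <= nedges P)%nat -> (0 < cap P i)%nat).

Definition nvertices (P : path) : nat := S (nedges P).

(** Vertices [a .. b] of [P], renumbered from [0]. *)
Definition subpath (P : path) (a b : nat) : path :=
  {| nedges := b - a;
     vpos := fun i => vpos P (a + i);
     tau := tau P;
     weight := fun i => weight P (a + i)%nat;
     cap := fun i => cap P (a + i)%nat |}.

(** Reflection [x |-> - x]: vertex [i] becomes vertex [nedges Q - i], so edge
    [i] becomes edge [nedges Q + 1 - i]. *)
Definition mirror (Q : path) : path :=
  {| nedges := nedges Q;
     vpos := fun i => - vpos Q (nedges Q - i);
     tau := tau Q;
     weight := fun i => weight Q (nedges Q - i)%nat;
     cap := fun i => cap Q (S (nedges Q) - i)%nat |}.

(** * Discrete evacuation *)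

(** Time to travel from vertex [i] to vertex [i + 1].  On a dynamic path the
    argument of [Int_part] (the floor) is an integer, so nothing is rounded. *)
Definition hop_time (Q : path) (i : nat) : nat :=
  Z.to_nat (Int_part ((vpos Q (S i) - vpos Q i) * tau Q)).

(** When everyone moves to the right, [entered Q i t] is the number of people
    who have entered edge [i + 1], from vertex [i], at the integer times
    [0 .. t].  [present s] counts the people who started at [i] or reached
    [i] by time [s]; those of them who have not left yet form the queue, and
    as many of these as the capacity permits enter the edge at time [s].
    Only head counts are kept: the order within a queue does not affect
    them. *)
Fixpoint entered (Q : path) (i : nat) : nat -> nat :=
  let present (s : nat) : nat :=
    (weight Q i +
     match i with
     | O => 0
     | S h => if hop_time Q h <=? s then entered Q h (s - hop_time Q h) else 0
     end)%nat in
  fix go (t : nat) : nat :=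
    match t with
    | O => Nat.min (cap Q (S i)) (present O)
    | S s => (go s + Nat.min (cap Q (S i)) (present (S s) - go s))%nat
    end.

Definition people_upto (Q : path) (m : nat) : nat :=
  list_sum (map (weight Q) (seq 0 (S m))).

(** Everyone strictly to the left of the sink [y] has reached [y] by time [T].
    Here [m] is the last vertex to the left of [y]; a person entering edge
    [m + 1] at time [t] reaches [y] at time [t + (y - vpos Q m) * tau Q]. *)
Definition left_evacuated_by (Q : path) (y T : R) : Prop :=
  0 <= T
  /\ forall m, (m < nedges Q)%nat -> vpos Q m < y <= vpos Q (S m) ->
       people_upto Q m = 0%nat
       \/ exists t : nat, entered Q m t = people_upto Q m
                          /\ INR t + (y - vpos Q m) * tau Q <= T.

Definition is_minimum (S : R -> Prop) (m : R) : Prop :=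
  S m /\ forall s, S s -> m <= s.

Definition is_Theta_L (Q : path) (y T : R) : Prop :=
  is_minimum (left_evacuated_by Q y) T.

Definition is_Theta_R (Q : path) (y T : R) : Prop :=
  is_Theta_L (mirror Q) (- y) T.

Definition is_Theta (Q : path) (y T : R) : Prop :=
  exists TL TR, is_Theta_L Q y TL /\ is_Theta_R Q y TR /\ T = Rmax TL TR.

(** * Sink evacuation protocols *)

(** The [j]-th part, [1 <= j <= k]. *)
Definition part (P : path) (i : nat -> nat) (j : nat) : path :=
  subpath P (i (j - 1)%nat) (i j - 1)%nat.

Definition is_protocol (P : path) (k : nat) (i : nat -> nat) (y : nat -> R)
    : Prop :=
  i 0%nat = 0%nat /\ i k = nvertices P
  /\ (forall j, (j < k)%nat -> (i j < i (S j))%nat)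
  /\ (forall j, (1 <= j <= k)%nat ->
        vpos (part P i j) 0 <= y j <= vpos (part P i j) (nedges (part P i j))).

Definition is_protocol_time (P : path) (k : nat) (i : nat -> nat)
    (y : nat -> R) (T : R) : Prop :=
  exists theta : nat -> R,
    (forall j, (1 <= j <= k)%nat -> is_Theta (part P i j) (y j) (theta j))
    /\ (exists j, (1 <= j <= k)%nat /\ T = theta j)
    /\ (forall j, (1 <= j <= k)%nat -> theta j <= T).

Definition is_Theta_k (P : path) (k : nat) (T : R) : Prop :=
  is_minimum
    (fun T' => exists i y, is_protocol P k i y /\ is_protocol_time P k i y T')
    T.

(** * Real RAM programs *)

(** A program handles finitely many integer arrays and real arrays, which are
    named by natural numbers and indexed by integers.  As usual for a real
    RAM, arithmetic, comparisons and memory accesses have unit cost, and no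
    operation turns a real number into an integer.  There is deliberately no
    integer multiplication: integers only at most double at each step, so
    unit-cost arithmetic on them cannot be used to compute with numbers of
    exponential length.  [IDiv] rounds down. *)
Inductive iexp : Type :=
| IConst (z : Z)
| IGet (a : nat) (e : iexp)
| IAdd (e1 e2 : iexp)
| ISub (e1 e2 : iexp)
| IDiv (e1 e2 : iexp).

Inductive rexp : Type :=
| ROfInt (e : iexp)
| RGet (a : nat) (e : iexp)
| RAdd (e1 e2 : rexp)
| RSub (e1 e2 : rexp)
| RMul (e1 e2 : rexp)
| RDiv (e1 e2 : rexp).

Inductive bexp : Type :=
| ILe (e1 e2 : iexp)
| RLe (e1 e2 : rexp)
| BNot (b : bexp)
| BAnd (b1 b2 : bexp).

Inductive com : Type :=
| Skip
| ISet (a : nat) (idx e : iexp)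
| RSet (a : nat) (idx : iexp) (e : rexp)
| Seq (p1 p2 : com)
| If (b : bexp) (p1 p2 : com)
| While (b : bexp) (p : com).

Record store : Type := Store {
  ints : nat -> Z -> Z;
  reals : nat -> Z -> R }.

Fixpoint ieval (s : store) (e : iexp) : Z :=
  match e with
  | IConst z => z
  | IGet a e => ints s a (ieval s e)
  | IAdd e1 e2 => (ieval s e1 + ieval s e2)%Z
  | ISub e1 e2 => (ieval s e1 - ieval s e2)%Z
  | IDiv e1 e2 => (ieval s e1 / ieval s e2)%Z
  end.

Fixpoint reval (s : store) (e : rexp) : R :=
  match e with
  | ROfInt e => IZR (ieval s e)
  | RGet a e => reals s a (ieval s e)
  | RAdd e1 e2 => reval s e1 + reval s e2
  | RSub e1 e2 => reval s e1 - reval s e2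
  | RMul e1 e2 => reval s e1 * reval s e2
  | RDiv e1 e2 => reval s e1 / reval s e2
  end.

Fixpoint beval (s : store) (b : bexp) : bool :=
  match b with
  | ILe e1 e2 => (ieval s e1 <=? ieval s e2)%Z
  | RLe e1 e2 => if Rle_dec (reval s e1) (reval s e2) then true else false
  | BNot b => negb (beval s b)
  | BAnd b1 b2 => andb (beval s b1) (beval s b2)
  end.

Fixpoint icost (e : iexp) : nat :=
  match e with
  | IConst _ => 1
  | IGet _ e => S (icost e)
  | IAdd e1 e2 | ISub e1 e2 | IDiv e1 e2 => S (icost e1 + icost e2)
  end.

Fixpoint rcost (e : rexp) : nat :=
  match e with
  | ROfInt e | RGet _ e => S (icost e)
  | RAdd e1 e2 | RSub e1 e2 | RMul e1 e2 | RDiv e1 e2 =>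
      S (rcost e1 + rcost e2)
  end.

Fixpoint bcost (b : bexp) : nat :=
  match b with
  | ILe e1 e2 => S (icost e1 + icost e2)
  | RLe e1 e2 => S (rcost e1 + rcost e2)
  | BNot b => S (bcost b)
  | BAnd b1 b2 => S (bcost b1 + bcost b2)
  end.

Definition update {A : Type} (m : nat -> Z -> A) (a : nat) (z : Z) (v : A)
    : nat -> Z -> A :=
  fun a' z' => if andb (a' =? a)%nat (z' =? z)%Z then v else m a' z'.

Definition iset (s : store) (a : nat) (z v : Z) : store :=
  {| ints := update (ints s) a z v; reals := reals s |}.

Definition rset (s : store) (a : nat) (z : Z) (v : R) : store :=
  {| ints := ints s; reals := update (reals s) a z v |}.

(** [exec p s t s']: started in [s], the program [p] halts in [s'] after [t]
    unit-cost steps. *)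
Inductive exec : com -> store -> nat -> store -> Prop :=
| exec_skip s : exec Skip s 1 s
| exec_iset a idx e s :
    exec (ISet a idx e) s (S (icost idx + icost e))
      (iset s a (ieval s idx) (ieval s e))
| exec_rset a idx e s :
    exec (RSet a idx e) s (S (icost idx + rcost e))
      (rset s a (ieval s idx) (reval s e))
| exec_seq p1 p2 s t1 s1 t2 s2 :
    exec p1 s t1 s1 -> exec p2 s1 t2 s2 -> exec (Seq p1 p2) s (t1 + t2) s2
| exec_if b p1 p2 s t s' :
    exec (if beval s b then p1 else p2) s t s' ->
    exec (If b p1 p2) s (S (bcost b + t)) s'
| exec_while_false b p s :
    beval s b = false -> exec (While b p) s (S (bcost b)) s
| exec_while_true b p s t1 s1 t2 s2 :
    beval s b = true -> exec p s t1 s1 -> exec (While b p) s1 t2 s2 ->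
    exec (While b p) s (S (bcost b + t1 + t2)) s2.

(** * Input and output *)

(** The entries [f lo, ..., f hi] at their own indices, [zero] elsewhere. *)
Definition array {A : Type} (zero : A) (f : nat -> A) (lo hi : nat) (z : Z)
    : A :=
  if andb (Z.of_nat lo <=? z)%Z (z <=? Z.of_nat hi)%Z
  then f (Z.to_nat z) else zero.

Definition input (P : path) (k : nat) : store :=
  {| ints := fun a =>
       match a with
       | 0%nat => array 0%Z (fun _ => Z.of_nat (nedges P)) 0 0
       | 1%nat => array 0%Z (fun _ => Z.of_nat k) 0 0
       | 2%nat => array 0%Z (fun i => Z.of_nat (weight P i)) 0 (nedges P)
       | 3%nat => array 0%Z (fun i => Z.of_nat (cap P i)) 1 (nedges P)
       | _ => fun _ => 0%Z
       end;
     reals := fun a =>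
       match a with
       | 0%nat => array 0 (fun _ => tau P) 0 0
       | 1%nat => array 0 (vpos P) 0 (nedges P)
       | _ => fun _ => 0
       end |}.

(** The value [T] is read in real array [2], the indices [i 0 .. i k] in
    integer array [4] and the sinks [y 1 .. y k] in real array [3]. *)
Definition is_output (s : store) (k : nat) (T : R) (i : nat -> nat)
    (y : nat -> R) : Prop :=
  reals s 2 0%Z = T
  /\ (forall j, (j <= k)%nat -> ints s 4 (Z.of_nat j) = Z.of_nat (i j))
  /\ (forall j, (1 <= j <= k)%nat -> reals s 3 (Z.of_nat j) = y j).

(* Main.v *)
Require Import Defs.
From Stdlib Require Import Reals ZArith Arith List Lia Lra Classical.
Import ListNotations.
Open Scope R_scope.

(** Everything rests on two monotonicities of [one_sink]: it survives a larger time and a smaller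
    part. They make the greedy extension of parts optimal.

    The optimum is a real number, so bisection on times would never hit it exactly. Hence every
    search runs over indices, and the only times compared are values of parts.

    A sink may lie inside an edge. There the left and right times are affine with opposite slopes,
    so a best sink is an end of some edge or the crossing point on it.

    The left condition does not mention the far end of a part, nor the right condition its start. A
    greedy part can therefore be found by two successive searches: one for the rightmost sink that
    its left side tolerates, one for the farthest end that its right side then tolerates. Since both
    cost in proportion to the part found, the costs of the parts of one decision add up without a
    factor [k].

    A protocol has no empty parts, so each greedy part leaves one vertex for every part still to
    come; [k] is at most the number of vertices, so this is always possible. *)

(** The evacuation time of one side of a sink [y] is the largest of the numbers
    [d tau + (W - 1) / c], where a vertex at distance [d] and everything behind it
    carry [W > 0] people and [c] is the capacity of an edge between that vertex and
    [y] (division rounding down).  A single scan therefore computes it in linear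
    time, and a binary search over the vertices finds the optimal sink of a given
    part in time [O(n log n)].

    Given a time bound [T], whether [k] parts suffice is decided greedily, every
    part being extended as far as [T] permits.  Doubling search finds the end of a
    part of length [l] in time [O(l log l)], so a decision costs [O(n log n)].

    The optimum is located by a parametric search.  In each of [k] stages, with
    current start [a], binary search finds the least [b] such that the one-sink time
    of the part [a .. b] is a feasible bound; that time is a candidate, and [b] is
    the next start.  No bound below all candidates lets the greedy parts get past
    these starts, so the best candidate is optimal.  Each of the [k log n] steps
    costs [O(n log n)]. *)

(** * The discrete evacuation process *)

Definition psum (P : path) (j : nat) : nat := list_sum (map (weight P) (seq 0 j)).

Definition hop_sum (P : path) (j : nat) : nat := list_sum (map (hop_time P) (seq 0 j)).

Lemma list_sum_seq_S (f : nat -> nat) (j : nat) :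
  list_sum (map f (seq 0 (S j))) = (list_sum (map f (seq 0 j)) + f j)%nat.
Proof. rewrite seq_S, map_app, list_sum_app; cbn; lia. Qed.

Lemma psum_S P j : psum P (S j) = (psum P j + weight P j)%nat.
Proof. apply list_sum_seq_S. Qed.

Lemma hop_sum_S P j : hop_sum P (S j) = (hop_sum P j + hop_time P j)%nat.
Proof. apply list_sum_seq_S. Qed.

Lemma psum_le P i j : (i <= j)%nat -> (psum P i <= psum P j)%nat.
Proof. induction 1; [lia | rewrite psum_S; lia]. Qed.

Lemma hop_sum_le P i j : (i <= j)%nat -> (hop_sum P i <= hop_sum P j)%nat.
Proof. induction 1; [lia | rewrite hop_sum_S; lia]. Qed.

Lemma vpos_lt P i j :
  is_dynamic_path P -> (i < j <= nedges P)%nat -> vpos P i < vpos P j.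
Proof.
  intros (_ & Hx & _) [Hij Hj]; induction Hij.
  - apply Hx; lia.
  - apply Rlt_trans with (vpos P m); [apply IHHij; lia | apply Hx; lia].
Qed.

Lemma vpos_le P i j :
  is_dynamic_path P -> (i <= j <= nedges P)%nat -> vpos P i <= vpos P j.
Proof.
  intros HP [Hij Hj]; destruct (Nat.eq_dec i j) as [->|]; [lra|].
  apply Rlt_le, vpos_lt; auto; lia.
Qed.

Lemma hop_time_real P i :
  is_dynamic_path P -> (i < nedges P)%nat ->
  INR (hop_time P i) = (vpos P (S i) - vpos P i) * tau P.
Proof.
  intros HP Hi. pose proof HP as (Ht & Hx & Hz & _).
  destruct (Hz (S i) i) as [z Ez]; try lia.
  specialize (Hx i Hi).
  rewrite Rabs_right in Ez by lra.
  unfold hop_time. rewrite Ez, <- (Int_part_spec (IZR z) z) by lra.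
  rewrite INR_IZR_INZ, Z2Nat.id; auto.
  apply le_IZR; rewrite <- Ez; apply Rmult_le_pos; lra.
Qed.

Lemma hop_time_pos P i :
  is_dynamic_path P -> (i < nedges P)%nat -> (1 <= hop_time P i)%nat.
Proof.
  intros HP Hi. pose proof (hop_time_real P i HP Hi) as E.
  pose proof HP as (Ht & Hx & _). specialize (Hx i Hi).
  destruct (hop_time P i); [|lia].
  exfalso; cbn in E. assert (0 < (vpos P (S i) - vpos P i) * tau P); [|lra].
  apply Rmult_lt_0_compat; lra.
Qed.

Lemma hop_sum_real P i m :
  is_dynamic_path P -> (i <= m <= nedges P)%nat ->
  INR (hop_sum P m - hop_sum P i) = (vpos P m - vpos P i) * tau P.
Proof.
  intros HP Him.
  assert (E : forall j, (j <= nedges P)%nat ->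
            INR (hop_sum P j) = (vpos P j - vpos P 0) * tau P).
  { induction j; intros Hj.
    - cbn; lra.
    - rewrite hop_sum_S, plus_INR, IHj, hop_time_real by (auto; lia). lra. }
  rewrite minus_INR by (apply hop_sum_le; lia).
  rewrite !E by lia. lra.
Qed.

Definition present (Q : path) (i s : nat) : nat :=
  (weight Q i +
   match i with
   | O => 0
   | S h => if hop_time Q h <=? s then entered Q h (s - hop_time Q h) else 0
   end)%nat.

Lemma entered_0 Q i : entered Q i 0 = Nat.min (cap Q (S i)) (present Q i 0).
Proof. destruct i; reflexivity. Qed.

Lemma entered_S Q i s :
  entered Q i (S s)
  = (entered Q i s + Nat.min (cap Q (S i)) (present Q i (S s) - entered Q i s))%nat.
Proof. destruct i; reflexivity. Qed.

Lemma entered_mono Q i s t : (s <= t)%nat -> (entered Q i s <= entered Q i t)%nat.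
Proof. induction 1; [lia | rewrite entered_S; lia]. Qed.

Lemma present_mono Q i s t : (s <= t)%nat -> (present Q i s <= present Q i t)%nat.
Proof.
  intros H; unfold present; destruct i as [|h]; [lia|].
  destruct (Nat.leb_spec (hop_time Q h) s); destruct (Nat.leb_spec (hop_time Q h) t);
    try lia.
  apply Nat.add_le_mono_l, entered_mono; lia.
Qed.

Lemma entered_le_present Q i t : (entered Q i t <= present Q i t)%nat.
Proof.
  induction t as [|t IH].
  - rewrite entered_0; lia.
  - rewrite entered_S. pose proof (present_mono Q i t (S t)). lia.
Qed.

Lemma entered_S_min Q i s :
  entered Q i (S s) = Nat.min (entered Q i s + cap Q (S i)) (present Q i (S s)).
Proof.
  rewrite entered_S. pose proof (entered_le_present Q i s).
  pose proof (present_mono Q i s (S s)). lia.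
Qed.

(* The queues form a chain of constant-rate servers.  For each start vertex [i]
   and each later edge [e], everyone who started after [i] may have entered
   edge [m + 1], while those from [0 .. i] have had to pass [e] within
   [t + 1 - d] steps, [d] being the travel time from [i] to [m]; the smallest
   of these bounds is attained. *)
Lemma le_entered_iff Q m :
  is_dynamic_path Q -> (m < nedges Q)%nat -> forall t N,
  (N <= entered Q m t)%nat <->
  (N <= psum Q (S m))%nat /\
  forall i e, (i <= m)%nat -> (i < e <= S m)%nat ->
    (N <= (psum Q (S m) - psum Q (S i))
          + cap Q e * (S t - (hop_sum Q m - hop_sum Q i)))%nat.
Proof.
  intros HQ. induction m as [|m IHm]; intros Hm.
  - assert (A : forall t, present Q 0 t = psum Q 1)
      by (intros t; unfold present; rewrite psum_S; cbn; lia).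
    induction t as [|t IHt]; intros N.
    + rewrite entered_0, A, Nat.min_glb_iff. split.
      * intros [H1 H2]; split; auto. intros i e Hi He.
        replace i with 0%nat by lia; replace e with 1%nat by lia. lia.
      * intros [H1 H2]; split; auto. specialize (H2 0%nat 1%nat). lia.
    + rewrite entered_S_min, A, Nat.min_glb_iff.
      rewrite <- Nat.le_sub_le_add_r, IHt. split.
      * intros [[H1 H2] H3]; split; auto. intros i e Hi He.
        specialize (H2 0%nat 1%nat).
        replace i with 0%nat by lia; replace e with 1%nat by lia.
        rewrite !Nat.sub_diag in *. nia.
      * intros [H1 H2]; split; auto; split; [lia|]. intros i e Hi He.
        specialize (H2 0%nat 1%nat).
        replace i with 0%nat by lia; replace e with 1%nat by lia.
        rewrite !Nat.sub_diag in *. nia.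
  - specialize (IHm ltac:(lia)).
    pose proof (hop_time_pos Q m HQ ltac:(lia)) as Hd.
    assert (D : forall i, (i <= m)%nat ->
              (hop_sum Q (S m) - hop_sum Q i
               = (hop_sum Q m - hop_sum Q i) + hop_time Q m)%nat).
    { intros i Hi. rewrite hop_sum_S. pose proof (hop_sum_le Q i m Hi). lia. }
    assert (W : forall i, (i <= m)%nat ->
              (psum Q (S (S m)) - psum Q (S i)
               = (psum Q (S m) - psum Q (S i)) + weight Q (S m))%nat).
    { intros i Hi. rewrite (psum_S Q (S m)).
      pose proof (psum_le Q (S i) (S m) ltac:(lia)). lia. }
    (* Arrivals at [S m] are the entries into edge [S m], delayed by its hop time. Before the first
       arrival the constraint for [m] and edge [S m] has time factor zero and leaves only the people
       starting at [S m]. *)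
    assert (A : forall t N, (N <= present Q (S m) t)%nat <->
              (N <= psum Q (S (S m)))%nat /\
              forall i e, (i <= m)%nat -> (i < e <= S m)%nat ->
              (N <= (psum Q (S (S m)) - psum Q (S i))
                 + cap Q e * (S t - (hop_sum Q (S m) - hop_sum Q i)))%nat).
    { intros t N. unfold present.
      destruct (Nat.leb_spec (hop_time Q m) t) as [Ht|Ht].
      - rewrite Nat.add_comm, <- Nat.le_sub_le_add_r, IHm.
        rewrite (psum_S Q (S m)) at 1.
        assert (T : forall i, (S t - (hop_sum Q m - hop_sum Q i + hop_time Q m)
                   = S (t - hop_time Q m) - (hop_sum Q m - hop_sum Q i))%nat)
          by (intros i; lia).
        split; intros [H1 H2]; split; try lia; intros i e Hi He;
          specialize (H2 i e Hi He).
        + rewrite (W i Hi), (D i Hi), T.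
          eapply Nat.le_trans; [apply Nat.le_sub_le_add_r, H2|].
          apply Nat.eq_le_incl. ring.
        + rewrite (W i Hi), (D i Hi), T in H2.
          apply Nat.le_sub_le_add_r. eapply Nat.le_trans; [apply H2|].
          apply Nat.eq_le_incl. ring.
      - rewrite Nat.add_0_r. split.
        + intros H; split; [rewrite (psum_S Q (S m)); lia|].
          intros i e Hi He. rewrite (W i Hi).
          generalize (cap Q e * (S t - (hop_sum Q (S m) - hop_sum Q i)))%nat; lia.
        + intros [_ H]. specialize (H m (S m) ltac:(lia) ltac:(lia)).
          rewrite (W m ltac:(lia)), (D m ltac:(lia)) in H.
          replace (S t - (hop_sum Q m - hop_sum Q m + hop_time Q m))%nat
            with 0%nat in H by lia.
          lia. }
    induction t as [|t IHt]; intros N.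
    + rewrite entered_0, Nat.min_glb_iff, A. split.
      * intros [H1 [H2 H3]]; split; auto. intros i e Hi He.
        destruct (Nat.eq_dec i (S m)) as [->|].
        { replace e with (S (S m)) by lia. rewrite !Nat.sub_diag. lia. }
        destruct (Nat.eq_dec e (S (S m))) as [->|]; [|apply H3; lia].
        (* Every hop takes at least one step, so at time [0] the time factor vanishes and the last
           edge gives the same bound as edge [S m]. *)
        specialize (H3 i (S m) ltac:(lia) ltac:(lia)).
        pose proof (D i ltac:(lia)).
        replace (1 - (hop_sum Q (S m) - hop_sum Q i))%nat with 0%nat in * by lia.
        lia.
      * intros [H2 H3]. split; [|split; auto].
        { specialize (H3 (S m) (S (S m)) ltac:(lia) ltac:(lia)). lia. }
        intros i e Hi He. apply H3; lia.
    + rewrite entered_S_min, Nat.min_glb_iff, A, <- Nat.le_sub_le_add_r, IHt. split.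
      * intros [[H1 H2] [H3 H4]]; split; auto. intros i e Hi He.
        destruct (Nat.eq_dec e (S (S m))) as [->|]; [|apply H4; lia].
        specialize (H2 i (S (S m)) Hi ltac:(lia)).
        destruct (le_gt_dec (hop_sum Q (S m) - hop_sum Q i) (S t)) as [Hl|Hl]; [nia|].
        destruct (Nat.eq_dec i (S m)) as [->|]; [lia|].
        specialize (H4 i (S m) ltac:(lia) ltac:(lia)). nia.
      * intros [H1 H2]; split; split; auto; [lia| |].
        { intros i e Hi He.
          pose proof (H2 i e Hi He) as G1.
          pose proof (H2 i (S (S m)) Hi ltac:(lia)) as G2.
          set (q := (hop_sum Q (S m) - hop_sum Q i)%nat) in *.
          (* One step of the last edge has to be taken off. If [e] is no wider than that edge, its
             own constraint suffices; otherwise that of the last edge does. *)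
          destruct (le_gt_dec (cap Q e) (cap Q (S (S m)))); nia. }
        intros i e Hi He. apply H2; lia.
Qed.

(** The ceiling of [w / c] is [(w - 1) / c + 1]; this is where the [W - 1] in the evacuation formula
    comes from. *)
Lemma le_mul_iff_div (w c q : nat) :
  (0 < w)%nat -> (0 < c)%nat -> (w <= c * q)%nat <-> ((w - 1) / c < q)%nat.
Proof.
  intros Hw Hc. split; intros H.
  - apply Nat.Div0.div_lt_upper_bound; lia.
  - pose proof (Nat.div_mod_eq (w - 1) c). pose proof (Nat.mod_upper_bound (w - 1) c). nia.
Qed.

(** When [N] counts everyone, those who started after [i] cancel, and each constraint of
    [le_entered_iff] becomes a lower bound on [t]. *)
Lemma entered_all_iff Q m t :
  is_dynamic_path Q -> (m < nedges Q)%nat ->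
  entered Q m t = people_upto Q m <->
  forall i e, (i <= m)%nat -> (i < e <= S m)%nat -> (0 < psum Q (S i))%nat ->
    ((psum Q (S i) - 1) / cap Q e + (hop_sum Q m - hop_sum Q i) <= t)%nat.
Proof.
  intros HQ Hm. change (people_upto Q m) with (psum Q (S m)).
  pose proof (le_entered_iff Q m HQ Hm t) as E.
  pose proof HQ as (_ & _ & _ & Hc).
  transitivity (psum Q (S m) <= entered Q m t)%nat.
  { pose proof (proj1 (E _) (le_n _)). lia. }
  rewrite E. split.
  - intros [_ H] i e Hi He Hw. specialize (H i e Hi He).
    pose proof (psum_le Q (S i) (S m) ltac:(lia)).
    assert (H' : (psum Q (S i) <= cap Q e * (S t - (hop_sum Q m - hop_sum Q i)))%nat).
    { revert H. generalize (cap Q e * (S t - (hop_sum Q m - hop_sum Q i)))%nat. lia. }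
    apply le_mul_iff_div in H'; [lia | auto | apply Hc; lia].
  - intros H; split; auto. intros i e Hi He. specialize (H i e Hi He).
    pose proof (psum_le Q (S i) (S m) ltac:(lia)).
    assert (H' : (psum Q (S i) <= cap Q e * (S t - (hop_sum Q m - hop_sum Q i)))%nat).
    { destruct (Nat.eq_dec (psum Q (S i)) 0) as [E0|E0]; [rewrite E0; apply Nat.le_0_l|].
      specialize (H ltac:(lia)).
      apply le_mul_iff_div; [lia | apply Hc; lia | lia]. }
    revert H'. generalize (cap Q e * (S t - (hop_sum Q m - hop_sum Q i)))%nat. lia.
Qed.

Lemma straddling_edge Q y :
  is_dynamic_path Q -> forall N, (N <= nedges Q)%nat ->
  vpos Q 0 < y <= vpos Q N ->
  exists m, (m < N)%nat /\ vpos Q m < y <= vpos Q (S m).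
Proof.
  intros HQ. induction N as [|N IH]; intros HN Hy; [lra|].
  destruct (Rlt_le_dec (vpos Q N) y) as [H|H].
  - exists N; split; [lia|lra].
  - destruct IH as (m & Hm & Hy'); [lia|lra|]. exists m; split; [lia|lra].
Qed.

Lemma left_evacuated_by_iff Q y T :
  is_dynamic_path Q -> y <= vpos Q (nedges Q) ->
  left_evacuated_by Q y T <->
  0 <= T /\
  forall i h, (i <= h < nedges Q)%nat -> vpos Q h < y -> (0 < psum Q (S i))%nat ->
    (y - vpos Q i) * tau Q + INR ((psum Q (S i) - 1) / cap Q (S h)) <= T.
Proof.
  intros HQ Hy. pose proof HQ as (Ht & _). unfold left_evacuated_by. split.
  - intros [H0 H]; split; auto. intros i h Hi Hh Hw.
    destruct (straddling_edge Q y HQ (nedges Q) (le_n _)) as (m & Hm & Hym).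
    { pose proof (vpos_le Q 0 h HQ ltac:(lia)). lra. }
    assert (Hhm : (h <= m)%nat).
    { destruct (le_gt_dec h m); auto.
      pose proof (vpos_le Q (S m) h HQ ltac:(lia)). lra. }
    destruct (H m Hm Hym) as [Z|(t & Et & HtT)].
    { change (people_upto Q m) with (psum Q (S m)) in Z.
      pose proof (psum_le Q (S i) (S m) ltac:(lia)). lia. }
    rewrite entered_all_iff in Et by auto.
    specialize (Et i (S h) ltac:(lia) ltac:(lia) Hw).
    apply le_INR in Et. rewrite plus_INR, hop_sum_real in Et by (auto; lia).
    lra.
  - intros [H0 H]; split; auto. intros m Hm Hym.
    destruct (Nat.eq_dec (people_upto Q m) 0) as [|Hp]; [left; auto|right].
    change (people_upto Q m) with (psum Q (S m)) in Hp.
    (* The latest integer time at which one may enter the last edge and still reach [y] by [T]. *)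
    set (z := Int_part (T - (y - vpos Q m) * tau Q)).
    destruct (base_Int_part (T - (y - vpos Q m) * tau Q)) as [Z1 Z2]. fold z in Z1, Z2.
    assert (Hz : forall q : nat, INR q <= T - (y - vpos Q m) * tau Q ->
                 (Z.of_nat q <= z)%Z).
    { intros q Hq. rewrite INR_IZR_INZ in Hq.
      assert (IZR (Z.of_nat q) < IZR (z + 1)) by (rewrite plus_IZR; lra).
      apply lt_IZR in H1. lia. }
    assert (z0 : (0 <= z)%Z).
    { apply (Hz 0%nat). cbn [INR].
      specialize (H m m ltac:(lia) ltac:(lra) ltac:(lia)).
      pose proof (pos_INR ((psum Q (S m) - 1) / cap Q (S m))). lra. }
    exists (Z.to_nat z). split.
    + apply entered_all_iff; auto. intros i e Hi He Hw.
      destruct e as [|h]; [lia|].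
      assert (vpos Q h < y) by (pose proof (vpos_le Q h m HQ ltac:(lia)); lra).
      specialize (H i h ltac:(lia) ltac:(lra) Hw).
      apply Nat2Z.inj_le. rewrite Z2Nat.id by auto. apply Hz.
      rewrite plus_INR, hop_sum_real by (auto; lia). lra.
    + rewrite INR_IZR_INZ, Z2Nat.id by auto. lra.
Qed.

(** * Evacuation times of subpaths *)

(* [y] evacuates the vertices from [a] on, resp. up to [b], that lie on its left,
   resp. right, within [T].  The bottleneck capacity between a vertex and [y] is
   not mentioned: every edge on the way gives a bound.  The edges are
   [h + 1] with [i <= h], resp. [e] with [e <= i]. *)
Definition left_ok (P : path) (a : nat) (T y : R) : Prop :=
  0 <= T /\
  forall i h, (a <= i <= h)%nat -> (h < nedges P)%nat -> vpos P h < y ->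
    (psum P a < psum P (S i))%nat ->
    (y - vpos P i) * tau P + INR ((psum P (S i) - psum P a - 1) / cap P (S h)) <= T.

Definition right_ok (P : path) (b : nat) (T y : R) : Prop :=
  0 <= T /\
  forall e i, (e <= i <= b)%nat -> y < vpos P e ->
    (psum P i < psum P (S b))%nat ->
    (vpos P i - y) * tau P + INR ((psum P (S b) - psum P i - 1) / cap P e) <= T.

Definition one_sink (P : path) (a b : nat) (T : R) : Prop :=
  exists y, vpos P a <= y <= vpos P b /\ left_ok P a T y /\ right_ok P b T y.

(** A minimum of an upward closed set, phrased as an equivalence so that it can be rewritten and
    intersected with other constraints. *)
Definition is_ray (U : R -> Prop) (M : R) : Prop := forall T, U T <-> M <= T.

Lemma is_ray_minimum U M : is_ray U M -> is_minimum U M.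
Proof. intros H; split; [apply H; lra | intros s Hs; apply H, Hs]. Qed.

(** The conjunct [0 <= T] gives the empty family a least element. *)
Lemma ray_forall (U : nat -> R -> Prop) (N : nat) :
  (forall i, (i < N)%nat -> exists M, is_ray (fun T => 0 <= T /\ U i T) M) ->
  exists M, is_ray (fun T => 0 <= T /\ forall i, (i < N)%nat -> U i T) M.
Proof.
  induction N as [|N IH]; intros H.
  - exists 0; intros T; split; [tauto|]. intros; split; auto; intros; lia.
  - destruct IH as [M1 H1]; [intros; apply H; lia|].
    destruct (H N) as [M2 H2]; [lia|].
    exists (Rmax M1 M2); intros T.
    assert (E : Rmax M1 M2 <= T <-> M1 <= T /\ M2 <= T).
    { split; [|intros []; apply Rmax_lub; auto].
      pose proof (Rmax_l M1 M2); pose proof (Rmax_r M1 M2); lra. }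
    rewrite E, <- (H1 T), <- (H2 T). split.
    + intros [H0 HU]; repeat split; auto.
    + intros [[H0 HU] [_ HN]]; split; auto.
      intros i Hi. destruct (Nat.eq_dec i N) as [->|]; auto. apply HU; lia.
Qed.

Lemma ray_bound (A : Prop) (c : R) :
  exists M, is_ray (fun T => 0 <= T /\ (A -> c <= T)) M.
Proof.
  destruct (classic A) as [HA|HA].
  - exists (Rmax 0 c); intros T. split.
    + intros [H0 H]; apply Rmax_lub; auto.
    + intros H. pose proof (Rmax_l 0 c); pose proof (Rmax_r 0 c).
      split; [|intros _]; lra.
  - exists 0; intros T; tauto.
Qed.

Lemma left_ray P a y : exists M, is_ray (fun T => left_ok P a T y) M.
Proof.
  set (N := nedges P).
  destruct (ray_forall (fun i T => forall h, (h < N)%nat ->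
     (a <= i <= h)%nat /\ vpos P h < y /\ (psum P a < psum P (S i))%nat ->
     (y - vpos P i) * tau P + INR ((psum P (S i) - psum P a - 1) / cap P (S h)) <= T) N)
    as [M HM].
  { intros i Hi. apply ray_forall. intros h Hh. apply ray_bound. }
  exists M. intros T. rewrite <- (HM T). unfold left_ok.
  split; intros [H0 H]; split; auto.
  - intros i Hi h Hh (H1 & H2 & H3). apply H; auto.
  - intros i h H1 H2 H3 H4. unfold N in H. apply H; auto; lia.
Qed.

Lemma right_ray P b y : exists M, is_ray (fun T => right_ok P b T y) M.
Proof.
  destruct (ray_forall (fun i T => forall e, (e < S b)%nat ->
     (e <= i <= b)%nat /\ y < vpos P e /\ (psum P i < psum P (S b))%nat ->
     (vpos P i - y) * tau P + INR ((psum P (S b) - psum P i - 1) / cap P e) <= T) (S b))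
    as [M HM].
  { intros i Hi. apply ray_forall. intros h Hh. apply ray_bound. }
  exists M. intros T. rewrite <- (HM T). unfold right_ok.
  split; intros [H0 H]; split; auto.
  - intros i Hi h Hh (H1 & H2 & H3). apply H; auto.
  - intros e i H1 H2 H3. apply H; auto; lia.
Qed.

Lemma subpath_dynamic P a b :
  is_dynamic_path P -> (a <= b <= nedges P)%nat -> is_dynamic_path (subpath P a b).
Proof.
  intros (Ht & Hx & Hz & Hc) Hab. unfold is_dynamic_path; cbn.
  repeat split; auto.
  - intros i Hi. replace (a + S i)%nat with (S (a + i)) by lia. apply Hx; lia.
  - intros i j Hi Hj. apply Hz; lia.
  - intros i Hi. apply Hc; lia.
Qed.

Lemma mirror_dynamic Q : is_dynamic_path Q -> is_dynamic_path (mirror Q).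
Proof.
  intros (Ht & Hx & Hz & Hc). unfold is_dynamic_path; cbn [mirror nedges tau vpos cap].
  repeat split; auto.
  - intros i Hi. apply Ropp_lt_contravar.
    replace (nedges Q - i)%nat with (S (nedges Q - S i)) by lia. apply Hx; lia.
  - intros i j Hi Hj.
    destruct (Hz (nedges Q - j) (nedges Q - i))%nat as [z Ez]; try lia.
    exists z. rewrite <- Ez. f_equal. f_equal. lra.
  - intros i Hi. apply Hc; lia.
Qed.

Lemma psum_subpath P a b j :
  (psum (subpath P a b) j = psum P (a + j) - psum P a)%nat.
Proof.
  assert (psum P (a + j) = psum P a + psum (subpath P a b) j)%nat; [|lia].
  induction j as [|j IH].
  - rewrite Nat.add_0_r. cbn. lia.
  - rewrite Nat.add_succ_r, !psum_S, IH. cbn [weight subpath]. lia.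
Qed.

Lemma psum_mirror Q j :
  (j <= S (nedges Q))%nat ->
  psum (mirror Q) j = (psum Q (S (nedges Q)) - psum Q (S (nedges Q) - j))%nat.
Proof.
  intros Hj.
  assert (psum (mirror Q) j + psum Q (S (nedges Q) - j) = psum Q (S (nedges Q)))%nat; [|lia].
  induction j as [|j IH].
  - rewrite Nat.sub_0_r. reflexivity.
  - rewrite <- IH by lia. rewrite psum_S. cbn [weight mirror].
    replace (S (nedges Q) - j)%nat with (S (nedges Q - j)) by lia.
    rewrite (psum_S Q (nedges Q - j)).
    replace (S (nedges Q) - S j)%nat with (nedges Q - j)%nat by lia. lia.
Qed.

Lemma left_evacuated_by_subpath P a b y T :
  is_dynamic_path P -> (a <= b <= nedges P)%nat -> y <= vpos P b ->
  left_evacuated_by (subpath P a b) y T <-> left_ok P a T y.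
Proof.
  intros HP Hab Hy.
  rewrite left_evacuated_by_iff; [|apply subpath_dynamic; auto|].
  2: { cbn. replace (a + (b - a))%nat with b by lia. auto. }
  cbn [subpath nedges vpos tau cap]. unfold left_ok.
  split; intros [H0 H]; split; auto.
  - intros i h Hi Hh Hhy Hw.
    assert (h < b)%nat.
    { destruct (le_gt_dec b h); auto. pose proof (vpos_le P b h HP ltac:(lia)). lra. }
    specialize (H (i - a) (h - a))%nat. rewrite psum_subpath in H.
    replace (a + (i - a))%nat with i in H by lia.
    replace (a + (h - a))%nat with h in H by lia.
    replace (a + S (i - a))%nat with (S i) in H by lia.
    replace (a + S (h - a))%nat with (S h) in H by lia.
    apply H; auto; lia.
  - intros i h Hi Hhy Hw. rewrite psum_subpath in *.
    specialize (H (a + i) (a + h))%nat.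
    replace (a + S h)%nat with (S (a + h)) by lia.
    replace (a + S i)%nat with (S (a + i)) in * by lia.
    apply H; auto; lia.
Qed.

Lemma left_evacuated_by_mirror P a b y T :
  is_dynamic_path P -> (a <= b <= nedges P)%nat -> vpos P a <= y ->
  left_evacuated_by (mirror (subpath P a b)) (- y) T <-> right_ok P b T y.
Proof.
  intros HP Hab Hy.
  rewrite left_evacuated_by_iff; [|apply mirror_dynamic, subpath_dynamic; auto|].
  2: { cbn. replace (a + (b - a - (b - a)))%nat with a by lia. lra. }
  (* Prefix sums of the mirrored part are suffix sums of the original one. *)
  assert (W : forall i, (i <= b - a)%nat ->
    psum (mirror (subpath P a b)) (S i) = (psum P (S b) - psum P (b - i))%nat).
  { intros i Hi. rewrite psum_mirror by (cbn; lia). rewrite !psum_subpath.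
    cbn [subpath nedges].
    replace (a + S (b - a))%nat with (S b) by lia.
    replace (a + (S (b - a) - S i))%nat with (b - i)%nat by lia.
    pose proof (psum_le P a (b - i) ltac:(lia)). lia. }
  cbn [mirror subpath nedges vpos tau cap]. unfold right_ok.
  split; intros [H0 H]; split; auto.
  - intros e i Hi Hhy Hw.
    assert (a < e)%nat.
    { destruct (le_gt_dec e a); auto. pose proof (vpos_le P e a HP ltac:(lia)). lra. }
    specialize (H (b - i) (b - e))%nat. rewrite W in H by lia.
    replace (a + (b - a - (b - i)))%nat with i in H by lia.
    replace (a + (b - a - (b - e)))%nat with e in H by lia.
    replace (b - (b - i))%nat with i in H by lia.
    replace (a + (S (b - a) - S (b - e)))%nat with e in H by lia.
    replace (vpos P i - y) with (- y - - vpos P i) by ring.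
    apply H; try lia. lra.
  - intros i h Hi Hhy Hw. rewrite W in * by lia.
    specialize (H (b - h) (b - i))%nat.
    replace (a + (b - a - h))%nat with (b - h)%nat in * by lia.
    replace (a + (b - a - i))%nat with (b - i)%nat by lia.
    replace (a + (S (b - a) - S h))%nat with (b - h)%nat by lia.
    replace (- y - - vpos P (b - i)) with (vpos P (b - i) - y) by ring.
    apply H; try lia. lra.
Qed.

(** A decision only certifies an upper bound [T], whereas the time of a protocol is built from exact
    values. *)
Lemma is_Theta_exists P a b y T :
  is_dynamic_path P -> (a <= b <= nedges P)%nat -> vpos P a <= y <= vpos P b ->
  left_ok P a T y -> right_ok P b T y ->
  exists theta, is_Theta (subpath P a b) y theta /\ theta <= T.
Proof.
  intros HP Hab Hy HL HR.
  destruct (left_ray P a y) as [ML EL]. destruct (right_ray P b y) as [MR ER].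
  exists (Rmax ML MR). split.
  - exists ML, MR. split; [|split; [|reflexivity]].
    + apply is_ray_minimum. intros T'. rewrite left_evacuated_by_subpath; auto; lra.
    + apply is_ray_minimum. intros T'. rewrite left_evacuated_by_mirror; auto; lra.
  - apply Rmax_lub; [apply EL | apply ER]; auto.
Qed.

Lemma left_ok_le_time P a y T T' : T <= T' -> left_ok P a T y -> left_ok P a T' y.
Proof.
  intros HT [H0 H]; split; [lra|]. intros i h H1 H2 H3 H4.
  specialize (H i h H1 H2 H3 H4). lra.
Qed.

Lemma right_ok_le_time P b y T T' : T <= T' -> right_ok P b T y -> right_ok P b T' y.
Proof.
  intros HT [H0 H]; split; [lra|]. intros i h H1 H2 H3.
  specialize (H i h H1 H2 H3). lra.
Qed.

Lemma is_Theta_one_sink P a b y theta T :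
  is_dynamic_path P -> (a <= b <= nedges P)%nat -> vpos P a <= y <= vpos P b ->
  is_Theta (subpath P a b) y theta -> theta <= T -> one_sink P a b T.
Proof.
  intros HP Hab Hy (TL & TR & [HL _] & [HR _] & ->) HT.
  pose proof (Rmax_l TL TR); pose proof (Rmax_r TL TR).
  rewrite left_evacuated_by_subpath in HL by (auto; lra).
  rewrite left_evacuated_by_mirror in HR by (auto; lra).
  exists y; split; [auto|split].
  - apply left_ok_le_time with TL; auto; lra.
  - apply right_ok_le_time with TR; auto; lra.
Qed.

(** * Optimal sinks and coverings *)

Lemma left_ok_le_sink P a T y y' :
  is_dynamic_path P -> y' <= y -> left_ok P a T y -> left_ok P a T y'.
Proof.
  intros (Ht & _) Hy [H0 H]; split; auto. intros i h H1 H2 H3 H4.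
  specialize (H i h H1 H2 ltac:(lra) H4).
  assert ((y' - vpos P i) * tau P <= (y - vpos P i) * tau P); [|lra].
  apply Rmult_le_compat_r; lra.
Qed.

Lemma right_ok_ge_sink P b T y y' :
  is_dynamic_path P -> y <= y' -> right_ok P b T y -> right_ok P b T y'.
Proof.
  intros (Ht & _) Hy [H0 H]; split; auto. intros e i H1 H2 H3.
  specialize (H e i H1 ltac:(lra) H3).
  assert ((vpos P i - y') * tau P <= (vpos P i - y) * tau P); [|lra].
  apply Rmult_le_compat_r; lra.
Qed.

Lemma left_ok_sub P a a' T y : (a <= a')%nat -> left_ok P a T y -> left_ok P a' T y.
Proof.
  intros Ha [H0 H]; split; auto. intros i h H1 H2 H3 H4.
  pose proof (psum_le P a a' Ha).
  specialize (H i h ltac:(lia) H2 H3 ltac:(lia)).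
  assert (E : ((psum P (S i) - psum P a' - 1) / cap P (S h)
               <= (psum P (S i) - psum P a - 1) / cap P (S h))%nat)
    by (apply Nat.Div0.div_le_mono; lia).
  apply le_INR in E. lra.
Qed.

Lemma right_ok_sub P b b' T y : (b' <= b)%nat -> right_ok P b T y -> right_ok P b' T y.
Proof.
  intros Hb [H0 H]; split; auto. intros e i H1 H2 H3.
  pose proof (psum_le P (S b') (S b) ltac:(lia)).
  specialize (H e i ltac:(lia) H2 ltac:(lia)).
  assert (E : ((psum P (S b') - psum P i - 1) / cap P e
               <= (psum P (S b) - psum P i - 1) / cap P e)%nat)
    by (apply Nat.Div0.div_le_mono; lia).
  apply le_INR in E. lra.
Qed.

Lemma left_ok_start P a T y :
  is_dynamic_path P -> y <= vpos P a -> 0 <= T -> left_ok P a T y.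
Proof.
  intros HP Hy HT; split; auto. intros i h H1 H2 H3.
  pose proof (vpos_le P a h HP ltac:(lia)). lra.
Qed.

Lemma right_ok_end P b T y :
  is_dynamic_path P -> (b <= nedges P)%nat -> vpos P b <= y -> 0 <= T ->
  right_ok P b T y.
Proof.
  intros HP Hb Hy HT; split; auto. intros e i H1 H2.
  pose proof (vpos_le P e b HP ltac:(lia)). lra.
Qed.

(* On a half-open edge the constraints do not change, and the arrival times
   are affine in the position of the sink. *)
Lemma left_ok_move P a v T y :
  is_dynamic_path P -> (v < nedges P)%nat -> vpos P v < y <= vpos P (S v) -> 0 <= T ->
  left_ok P a T y <-> left_ok P a (T + (vpos P (S v) - y) * tau P) (vpos P (S v)).
Proof.
  intros HP Hv Hy HT. pose proof HP as (Ht & _).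
  assert (0 <= (vpos P (S v) - y) * tau P) by (apply Rmult_le_pos; lra).
  split; intros [H0 H1]; (split; [lra|]); intros i h Hi Hh Hx Hw.
  - assert (h <= v)%nat.
    { destruct (le_gt_dec h v); auto. pose proof (vpos_le P (S v) h HP ltac:(lia)). lra. }
    pose proof (vpos_le P h v HP ltac:(lia)).
    specialize (H1 i h Hi Hh ltac:(lra) Hw). lra.
  - specialize (H1 i h Hi Hh ltac:(lra) Hw). lra.
Qed.

Lemma right_ok_move P b v T y :
  is_dynamic_path P -> (b <= nedges P)%nat -> (v < nedges P)%nat ->
  vpos P v <= y < vpos P (S v) -> 0 <= T ->
  right_ok P b T y <-> right_ok P b (T + (y - vpos P v) * tau P) (vpos P v).
Proof.
  intros HP Hb Hv Hy HT. pose proof HP as (Ht & _).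
  assert (0 <= (y - vpos P v) * tau P) by (apply Rmult_le_pos; lra).
  split; intros [H0 H1]; (split; [lra|]); intros e i Hi Hx Hw.
  - assert (S v <= e)%nat.
    { destruct (le_gt_dec (S v) e); auto.
      pose proof (vpos_le P e v HP ltac:(lia)). lra. }
    pose proof (vpos_le P (S v) e HP ltac:(lia)).
    specialize (H1 e i Hi ltac:(lra) Hw). lra.
  - specialize (H1 e i Hi ltac:(lra) Hw). lra.
Qed.

(** Anyone to the right of [v] has at least one whole edge to travel. This keeps the crossing value
    in [one_sink_value] nonnegative. *)
Lemma right_gap P b v B :
  is_dynamic_path P -> (v < nedges P)%nat -> (b <= nedges P)%nat ->
  is_ray (fun T => right_ok P b T (vpos P v)) B ->
  B <= 0 \/ (vpos P (S v) - vpos P v) * tau P <= B.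
Proof.
  intros HP Hv Hb HB. pose proof HP as (Ht & _).
  destruct (Rlt_le_dec B ((vpos P (S v) - vpos P v) * tau P)) as [H|H]; [left|auto].
  apply HB. split; [lra|]. intros e i Hi Hx Hw. exfalso.
  destruct (proj2 (HB B) ltac:(lra)) as [_ HR]. specialize (HR e i Hi Hx Hw).
  assert (S v <= e)%nat.
  { destruct (le_gt_dec (S v) e); auto. pose proof (vpos_le P e v HP ltac:(lia)). lra. }
  pose proof (vpos_le P (S v) i HP ltac:(lia)).
  pose proof (pos_INR ((psum P (S b) - psum P i - 1) / cap P e)).
  assert ((vpos P (S v) - vpos P v) * tau P <= (vpos P i - vpos P v) * tau P);
    [apply Rmult_le_compat_r|]; lra.
Qed.

Lemma one_sink_nonneg P a b T : one_sink P a b T -> 0 <= T.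
Proof. intros (y & _ & [H _] & _); auto. Qed.

Lemma one_sink_le_time P a b T T' : T <= T' -> one_sink P a b T -> one_sink P a b T'.
Proof.
  intros HT (y & Hy & HL & HR); exists y; split; [auto|split].
  - apply left_ok_le_time with T; auto.
  - apply right_ok_le_time with T; auto.
Qed.

Lemma one_sink_sub P a b a' b' T :
  is_dynamic_path P -> (a <= a' <= b')%nat -> (b' <= b <= nedges P)%nat ->
  one_sink P a b T -> one_sink P a' b' T.
Proof.
  intros HP Ha Hb (y & Hy & HL & HR).
  pose proof (vpos_le P a' b' HP ltac:(lia)).
  apply left_ok_sub with (a' := a') in HL; [|lia].
  apply right_ok_sub with (b' := b') in HR; [|lia].
  pose proof HL as [H0 _].
  (* The old sink is clamped to the smaller part. If that moves it to an end, the side it approaches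
     becomes empty and the other side only gets closer. *)
  exists (Rmax (vpos P a') (Rmin y (vpos P b'))).
  unfold Rmax, Rmin. repeat destruct Rle_dec; (split; [lra|split]); auto;
    try (apply left_ok_start; auto; lra); try (apply right_ok_end; auto; try lia; lra);
    try (apply left_ok_le_sink with y; auto; lra);
    try (apply right_ok_ge_sink with y; auto; lra).
Qed.

(* [v + 1] is the first vertex at which the left evacuation time is at least the
   right one, so an optimal sink lies on the edge before it: [A] and [B] are the
   values at its endpoints and the third candidate is the common value at the
   point where the two affine functions cross. *)
Lemma one_sink_value P a b v A B Rv Lu :
  is_dynamic_path P -> (a <= v < b)%nat -> (b <= nedges P)%nat ->
  is_ray (fun T => left_ok P a T (vpos P (S v))) A ->
  is_ray (fun T => right_ok P b T (vpos P (S v))) Rv ->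
  is_ray (fun T => left_ok P a T (vpos P v)) Lu ->
  is_ray (fun T => right_ok P b T (vpos P v)) B ->
  Rv <= A -> Lu < B ->
  is_ray (one_sink P a b)
    (Rmin A (Rmin B ((A + B - (vpos P (S v) - vpos P v) * tau P) / 2))).
Proof.
  intros HP Hv Hb HA HRv HLu HB HRA HLB T. pose proof HP as (Ht & Hx & _).
  specialize (Hx v ltac:(lia)).
  set (d := (vpos P (S v) - vpos P v) * tau P).
  assert (Hd : 0 < d) by (apply Rmult_lt_0_compat; lra).
  assert (Xa : vpos P a <= vpos P v) by (apply vpos_le; auto; lia).
  assert (Xb : vpos P (S v) <= vpos P b) by (apply vpos_le; auto; lia).
  assert (Lu0 : 0 <= Lu) by (apply (proj2 (HLu Lu) ltac:(lra))).
  assert (Hmin : forall x y z, Rmin x y <= z <-> x <= z \/ y <= z).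
  { intros; unfold Rmin; destruct Rle_dec; lra. }
  rewrite !Hmin. split.
  - intros (y & Hy & HL & HR). pose proof HL as [H0 _].
    destruct (Rle_lt_dec (vpos P (S v)) y) as [H|H].
    { left. apply HA, left_ok_le_sink with y; auto. }
    destruct (Rle_lt_dec y (vpos P v)) as [H'|H'].
    { right; left. apply HB, right_ok_ge_sink with y; auto. }
    right; right.
    (* In the sum of the two affine bounds the position of the sink cancels. *)
    rewrite (left_ok_move P a v) in HL by (auto; try lia; lra).
    rewrite (right_ok_move P b v) in HR by (auto; try lia; lra).
    apply HA in HL. apply HB in HR. unfold d. lra.
  - intros HT.
    destruct (Rle_lt_dec A T) as [H|H].
    { exists (vpos P (S v)); split; [lra|split]; [apply HA | apply HRv]; lra. }
    destruct (Rle_lt_dec B T) as [H'|H'].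
    { exists (vpos P v); split; [lra|split]; [apply HLu | apply HB]; lra. }
    assert (HT' : (A + B - d) / 2 <= T) by lra. clear HT.
    assert (H0 : 0 <= T).
    { destruct (right_gap P b v B); auto; try lia; [lra|]. fold d in H0.
      assert (0 <= A) by (apply (proj2 (HA A) ltac:(lra))). lra. }
    (* The point with left time [T]; by [HT'] its right time is at most [T]. *)
    set (y := vpos P (S v) - (A - T) / tau P).
    assert (Ey : (vpos P (S v) - y) * tau P = A - T) by (unfold y; field; lra).
    assert (Ey' : (y - vpos P v) * tau P = d - (A - T)) by (unfold d; lra).
    assert (y < vpos P (S v)).
    { apply Rmult_lt_reg_r with (tau P); lra. }
    assert (vpos P v < y).
    { apply Rmult_lt_reg_r with (tau P); lra. }
    exists y; split; [lra|split].
    + apply (left_ok_move P a v); auto; try lia; try lra. apply HA. lra.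
    + apply (right_ok_move P b v); auto; try lia; try lra. apply HB. lra.
Qed.

Lemma one_sink_value_start P a b Rv :
  is_dynamic_path P -> (a <= b <= nedges P)%nat ->
  is_ray (fun T => right_ok P b T (vpos P a)) Rv -> Rv <= 0 ->
  is_ray (one_sink P a b) 0.
Proof.
  intros HP Hab HR H T; split.
  - apply one_sink_nonneg.
  - intros HT. pose proof (vpos_le P a b HP ltac:(lia)).
    exists (vpos P a); split; [lra|split].
    + apply left_ok_start; auto; lra.
    + apply HR; lra.
Qed.

(* The rightmost sink that still evacuates its left side by [T] lies at [v] or
   on the edge after it, and [M] is the left evacuation time of [v + 1]. *)
Lemma left_ok_rightmost P a v T M :
  is_dynamic_path P -> (a <= v < nedges P)%nat ->
  left_ok P a T (vpos P v) -> ~ left_ok P a T (vpos P (S v)) ->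
  is_ray (fun T => left_ok P a T (vpos P (S v))) M ->
  let y := Rmax (vpos P v) (vpos P (S v) - (M - T) / tau P) in
  vpos P v <= y < vpos P (S v) /\ left_ok P a T y
  /\ forall y', left_ok P a T y' -> y' <= y.
Proof.
  intros HP Hv HL HN HM y. pose proof HP as (Ht & Hx & _).
  specialize (Hx v ltac:(lia)). pose proof HL as [H0 _].
  assert (HMT : T < M) by (destruct (Rlt_le_dec T M); auto; exfalso; apply HN, HM; auto).
  (* [z] may fall before [v]: just after [v] the left time jumps, because the people at [v] and the
     capacity of the next edge start to count. Then no interior point of the edge is admissible. *)
  set (z := vpos P (S v) - (M - T) / tau P) in *.
  assert (Ez : (vpos P (S v) - z) * tau P = M - T) by (unfold z; field; lra).
  assert (z < vpos P (S v)) by (apply Rmult_lt_reg_r with (tau P); lra).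
  assert (Y1 : vpos P v <= y) by apply Rmax_l.
  assert (Y2 : y < vpos P (S v)) by (apply Rmax_lub_lt; auto).
  split; [auto|split].
  - unfold y, Rmax. destruct Rle_dec as [Hz|Hz]; auto.
    destruct (Req_dec z (vpos P v)) as [->|]; auto.
    apply (left_ok_move P a v); auto; try lia; try lra. apply HM. lra.
  - intros y' HL'. destruct (Rle_lt_dec y' y) as [|Hy]; auto. exfalso.
    destruct (Rle_lt_dec (vpos P (S v)) y') as [|Hy'].
    { apply HN, left_ok_le_sink with y'; auto. }
    rewrite (left_ok_move P a v) in HL' by (auto; try lia; lra).
    apply HM in HL'. assert (z <= y) by apply Rmax_r.
    assert ((z - y') * tau P < 0 * tau P) by (apply Rmult_lt_compat_r; lra). lra.
Qed.

(* Parts are half-open here and may be empty; a protocol without empty parts is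
   recovered by the greedy decision procedure. *)
Definition okh (P : path) (T : R) (a b : nat) : Prop :=
  (a < b)%nat -> one_sink P a (b - 1) T.

Fixpoint cov (P : path) (T : R) (j b : nat) : Prop :=
  match j with
  | O => b = 0%nat
  | S j => exists a, (a <= b)%nat /\ cov P T j a /\ okh P T a b
  end.

Lemma cov_le_time P T T' j b : T <= T' -> cov P T j b -> cov P T' j b.
Proof.
  intros HT; revert b; induction j as [|j IH]; intros b; cbn; auto.
  intros (a & Hab & Hc & Ho). exists a; repeat split; auto.
  intros H. apply one_sink_le_time with T; auto.
Qed.

Lemma cov_nonneg P T j b : cov P T j b -> (0 < b)%nat -> 0 <= T.
Proof.
  revert b; induction j as [|j IH]; intros b; cbn; [lia|].
  intros (a & Hab & Hc & Ho) Hb. destruct (Nat.eq_dec a b) as [->|]; eauto.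
  apply one_sink_nonneg with P a (b - 1)%nat, Ho; lia.
Qed.

Lemma cov_pad P T i j b : (i <= j)%nat -> cov P T i b -> cov P T j b.
Proof.
  induction 1 as [|j _ IH]; auto. intros H. exists b.
  split; [lia|split; [auto|]]. intros Hb; lia.
Qed.

(** * Programs *)

(** A weakest precondition for total correctness. The postcondition also receives the running time,
    so cost and correctness are proved together. *)
Definition runs (p : com) (s : store) (Q : nat -> store -> Prop) : Prop :=
  exists t s', exec p s t s' /\ Q t s'.

Lemma runs_impl p s (Q Q' : nat -> store -> Prop) :
  runs p s Q -> (forall t s', Q t s' -> Q' t s') -> runs p s Q'.
Proof. intros (t & s' & He & HQ) H. exists t, s'; auto. Qed.

Lemma runs_skip s (Q : nat -> store -> Prop) : Q 1%nat s -> runs Skip s Q.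
Proof. intros H; exists 1%nat, s; split; auto; constructor. Qed.

Lemma runs_iset a idx e s (Q : nat -> store -> Prop) :
  Q (S (icost idx + icost e)) (iset s a (ieval s idx) (ieval s e)) ->
  runs (ISet a idx e) s Q.
Proof. intros H; do 2 eexists; split; [constructor | apply H]. Qed.

Lemma runs_rset a idx e s (Q : nat -> store -> Prop) :
  Q (S (icost idx + rcost e)) (rset s a (ieval s idx) (reval s e)) ->
  runs (RSet a idx e) s Q.
Proof. intros H; do 2 eexists; split; [constructor | apply H]. Qed.

Lemma runs_seq p1 p2 s (Q : nat -> store -> Prop) :
  runs p1 s (fun t1 s1 => runs p2 s1 (fun t2 s2 => Q (t1 + t2)%nat s2)) ->
  runs (Seq p1 p2) s Q.
Proof.
  intros (t1 & s1 & H1 & t2 & s2 & H2 & HQ).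
  exists (t1 + t2)%nat, s2; split; auto. econstructor; eauto.
Qed.

Lemma runs_if b p1 p2 s (Q : nat -> store -> Prop) :
  runs (if beval s b then p1 else p2) s (fun t => Q (S (bcost b + t))) ->
  runs (If b p1 p2) s Q.
Proof. intros (t & s' & H & HQ). do 2 eexists; split; [constructor; eauto | auto]. Qed.

(* [Inv t s] relates the store to the time [t] spent so far. *)
Lemma runs_while (Inv : nat -> store -> Prop) (m : store -> nat) b p s
    (Q : nat -> store -> Prop) :
  Inv 0%nat s ->
  (forall t s, Inv t s -> beval s b = true ->
     runs p s (fun t' s' => Inv (t + S (bcost b) + t')%nat s' /\ (m s' < m s)%nat)) ->
  (forall t s, Inv t s -> beval s b = false -> Q (t + S (bcost b))%nat s) ->
  runs (While b p) s Q.
Proof.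
  intros H0 Hs HQ.
  enough (G : forall n t s, (m s < n)%nat -> Inv t s ->
            runs (While b p) s (fun t' s' => Q (t + t')%nat s'))
    by (apply (G (S (m s)) 0%nat s); auto).
  clear s H0. induction n as [|n IH]; intros t s Hm HI; [lia|].
  destruct (beval s b) eqn:Eb.
  - destruct (Hs t s HI Eb) as (t1 & s1 & He1 & HI1 & Hm1).
    destruct (IH _ s1 ltac:(lia) HI1) as (t2 & s2 & He2 & HQ2).
    exists (S (bcost b + t1 + t2))%nat, s2. split.
    + econstructor; eauto.
    + replace (t + S (bcost b + t1 + t2))%nat
        with (t + S (bcost b) + t1 + t2)%nat by lia. auto.
  - exists (S (bcost b)), s. split; [constructor|]; auto.
Qed.

(** A syntactic over-approximation by whole arrays. It stays precise because each scalar occupies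
    cell [0] of an array of its own. *)
Fixpoint imods (p : com) : list nat :=
  match p with
  | ISet a _ _ => a :: nil
  | Seq p1 p2 | If _ p1 p2 => imods p1 ++ imods p2
  | While _ p => imods p
  | _ => nil
  end.

Fixpoint rmods (p : com) : list nat :=
  match p with
  | RSet a _ _ => a :: nil
  | Seq p1 p2 | If _ p1 p2 => rmods p1 ++ rmods p2
  | While _ p => rmods p
  | _ => nil
  end.

(** Boolean, so that on concrete lists [reflexivity] settles the side conditions. *)
Definition mem (a : nat) (l : list nat) : bool := existsb (Nat.eqb a) l.

Lemma mem_app a l1 l2 : mem a (l1 ++ l2) = false <-> mem a l1 = false /\ mem a l2 = false.
Proof. unfold mem. rewrite existsb_app. apply Bool.orb_false_iff. Qed.

Definition frame (li lr : list nat) (s s' : store) : Prop :=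
  (forall a z, mem a li = false -> ints s' a z = ints s a z)
  /\ (forall a z, mem a lr = false -> reals s' a z = reals s a z).

Lemma frame_refl li lr s : frame li lr s s.
Proof. split; auto. Qed.

Lemma frame_trans li lr s1 s2 s3 : frame li lr s1 s2 -> frame li lr s2 s3 -> frame li lr s1 s3.
Proof.
  intros [H1 H1'] [H2 H2']; split; intros a z Ha; [rewrite H2, H1 | rewrite H2', H1']; auto.
Qed.

Lemma frame_iset li lr s a z v s' :
  mem a li = true -> frame li lr (iset s a z v) s' -> frame li lr s s'.
Proof.
  intros Ha. apply frame_trans. split; intros b y Hb; cbn; [|reflexivity].
  unfold update. destruct (Nat.eqb_spec b a) as [->|]; [congruence | reflexivity].
Qed.

Lemma frame_rset li lr s a z v s' :
  mem a lr = true -> frame li lr (rset s a z v) s' -> frame li lr s s'.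
Proof.
  intros Ha. apply frame_trans. split; intros b y Hb; cbn; [reflexivity|].
  unfold update. destruct (Nat.eqb_spec b a) as [->|]; [congruence | reflexivity].
Qed.

Lemma frame_incl li lr li' lr' s s' :
  (forall a, mem a li' = false -> mem a li = false) ->
  (forall a, mem a lr' = false -> mem a lr = false) ->
  frame li lr s s' -> frame li' lr' s s'.
Proof. intros Hi Hr [H H']; split; auto. Qed.

Lemma exec_frame p s t s' : exec p s t s' -> frame (imods p) (rmods p) s s'.
Proof.
  induction 1; cbn [imods rmods];
    try (apply frame_refl).
  - split; intros b z; cbn; [|auto].
    unfold update. destruct (b =? a)%nat; [discriminate | reflexivity].
  - split; intros b z; cbn; [auto|].
    unfold update. destruct (b =? a)%nat; [discriminate | reflexivity].
  - apply frame_trans with s1; [eapply frame_incl, IHexec1 | eapply frame_incl, IHexec2];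
      intros a Ha; apply mem_app in Ha; tauto.
  - eapply frame_incl, IHexec; intros a Ha; apply mem_app in Ha;
      destruct (beval s b); tauto.
  - apply frame_trans with s1; auto.
Qed.

Lemma runs_frame p s (Q : nat -> store -> Prop) :
  runs p s Q -> runs p s (fun t s' => Q t s' /\ frame (imods p) (rmods p) s s').
Proof.
  intros (t & s' & He & HQ). exists t, s'; repeat split; auto;
    apply (exec_frame _ _ _ _ He).
Qed.

Notation iv s a := (ints s a%nat 0%Z).
Notation rv s a := (reals s a%nat 0%Z).

Definition V (a : nat) : iexp := IGet a (IConst 0).
Definition RV (a : nat) : rexp := RGet a (IConst 0).
Definition iassign (a : nat) (e : iexp) : com := ISet a (IConst 0) e.
Definition rassign (a : nat) (e : rexp) : com := RSet a (IConst 0) e.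

Fixpoint block (l : list com) : com :=
  match l with
  | nil => Skip
  | p :: nil => p
  | p :: l => Seq p (block l)
  end.

(* Static part of the store: the input and the prefix sums of the weights. *)
Definition holds_data (P : path) (k : nat) (s : store) : Prop :=
  iv s 0 = Z.of_nat (nedges P)
  /\ iv s 1 = Z.of_nat k
  /\ (forall i, (1 <= i <= nedges P)%nat -> ints s 3 (Z.of_nat i) = Z.of_nat (cap P i))
  /\ (forall j, (j <= S (nedges P))%nat -> ints s 5 (Z.of_nat j) = Z.of_nat (psum P j))
  /\ rv s 0 = tau P
  /\ (forall i, (i <= nedges P)%nat -> reals s 1 (Z.of_nat i) = vpos P i).

(** The arrays listed are those that [holds_data] reads. *)
Definition static (li lr : list nat) : bool :=
  forallb (fun a => negb (mem a li)) (0 :: 1 :: 3 :: 5 :: nil)%nat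
  && forallb (fun a => negb (mem a lr)) (0 :: 1 :: nil)%nat.

Lemma holds_data_frame P k li lr s s' :
  static li lr = true -> frame li lr s s' -> holds_data P k s -> holds_data P k s'.
Proof.
  unfold static, forallb. rewrite !Bool.andb_true_r, !Bool.andb_true_iff, !Bool.negb_true_iff.
  intros ((H0 & H1 & H3 & H5) & G0 & G1) [FI FR] (D0 & D1 & D3 & D5 & E0 & E1).
  unfold holds_data in *. repeat split; intros; rewrite ?FI, ?FR by auto; auto.
Qed.

Ltac framed :=
  repeat first
    [ apply frame_refl
    | match goal with
      | |- frame _ _ ?s (iset ?s' _ _ _) =>
          apply frame_trans with s';
          [|eapply frame_iset; [|apply frame_refl]; reflexivity]
      | |- frame _ _ ?s (rset ?s' _ _ _) =>
          apply frame_trans with s';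
          [|eapply frame_rset; [|apply frame_refl]; reflexivity]
      end ].

Ltac sim :=
  cbn [iassign rassign block iset rset ints reals ieval reval beval V RV update
       Nat.eqb Z.eqb andb negb icost rcost bcost mem existsb orb].

Ltac keep HD F HD' :=
  pose proof (fun e => holds_data_frame _ _ _ _ _ _ e F HD) as HD';
  specialize (HD' eq_refl).

(** * Scans *)

(* Integer cells: [6] far end of the scanned range, [7] current vertex or edge,
   [8] bottleneck capacity, [9] number of people; real cells: [4] sink,
   [5] maximum so far, [6] current candidate. *)
Definition narrow : com :=
  If (ILe (IGet 3 (V 7)) (V 8)) (iassign 8 (IGet 3 (V 7))) Skip.

Definition relax (dist : rexp) : com :=
  If (ILe (IConst 1) (V 9))
    (block
      [rassign 6 (RAdd (RMul dist (RV 0)) (ROfInt (IDiv (ISub (V 9) (IConst 1)) (V 8))));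
       If (RLe (RV 5) (RV 6)) (rassign 5 (RV 6)) Skip])
    Skip.

Lemma runs_narrow s :
  runs narrow s (fun t s' => (t <= 20)%nat /\ frame [8%nat] [] s s'
    /\ iv s' 8 = Z.min (iv s 8) (ints s 3%nat (iv s 7))).
Proof.
  unfold narrow. apply runs_if. sim.
  destruct (Z.leb_spec (ints s 3%nat (iv s 7)) (iv s 8)).
  - apply runs_iset. sim. split; [lia|]. split; [framed | lia].
  - apply runs_skip. split; [lia|]. split; [apply frame_refl | lia].
Qed.

(** The running maximum is described by its upper bounds, which is the form that [is_ray] asks
    for. *)
Lemma runs_relax dist s :
  (forall v, reval (rset s 6 0 v) dist = reval s dist) ->
  runs (relax dist) s (fun t s' => (t <= 30 + rcost dist)%nat /\ frame [] [5; 6]%nat s s'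
    /\ forall T, rv s' 5 <= T <->
         rv s 5 <= T /\ ((1 <= iv s 9)%Z ->
           reval s dist * rv s 0 + IZR ((iv s 9 - 1) / iv s 8) <= T)).
Proof.
  intros Hd. unfold relax. apply runs_if. sim.
  destruct (Z.leb_spec 1 (iv s 9)) as [H|H].
  - apply runs_seq, runs_rset. sim. apply runs_if. sim.
    destruct (Rle_dec (rv s 5) _) as [Hle|Hle].
    + apply runs_rset. sim. split; [lia|]. split; [framed|].
      intros T. split; [intros HT; split; [|intros _]; lra | intros [_ HT]; auto].
    + apply runs_skip. sim. split; [lia|]. split; [framed|].
      intros T. split; [intros HT; split; [|intros _]; lra | tauto].
  - apply runs_skip. split; [lia|]. split; [framed|].
    intros T. split; [intros; split; [auto | lia] | tauto].
Qed.

(** Vertex [e] is treated while cell [7] still holds [S e], the index both of the edge leaving [e]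
    to the right and of the prefix sum including [e]; the cell is decremented before the position is
    read. *)
Definition scan_left : com :=
  block
    [rassign 4 (RGet 1 (V 7)); iassign 8 (IGet 3 (V 7)); rassign 5 (ROfInt (IConst 0));
     While (ILe (IAdd (V 6) (IConst 1)) (V 7))
       (block
         [narrow;
          iassign 9 (ISub (IGet 5 (V 7)) (IGet 5 (V 6)));
          iassign 7 (ISub (V 7) (IConst 1));
          relax (RSub (RV 4) (RGet 1 (V 7)))])].

Definition scan_right : com :=
  block
    [iassign 8 (IGet 3 (V 7)); rassign 5 (ROfInt (IConst 0));
     While (ILe (V 7) (V 6))
       (block
         [narrow;
          iassign 9 (ISub (IGet 5 (IAdd (V 6) (IConst 1))) (IGet 5 (V 7)));
          relax (RSub (RGet 1 (V 7)) (RV 4));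
          iassign 7 (IAdd (V 7) (IConst 1))])].

(** The least capacity gives the largest quotient. This links the single bottleneck kept by a scan
    to the bounds for all edges in [left_ok] and [right_ok]. *)
Lemma bottleneck (c w : nat) (cp : nat -> nat) (D : nat -> Prop) (base T : R) :
  (0 < c)%nat -> (forall h, D h -> (c <= cp h)%nat) -> (exists h, D h /\ c = cp h) ->
  base + INR (w / c) <= T <-> forall h, D h -> base + INR (w / cp h) <= T.
Proof.
  intros Hc Hle (h0 & Hh0 & E0). split.
  - intros H h Hh.
    assert (E : (w / cp h <= w / c)%nat) by (apply Nat.div_le_compat_l; auto).
    apply le_INR in E. lra.
  - intros H. rewrite E0. auto.
Qed.

Lemma IZR_div_nat (u v c : nat) :
  (v < u)%nat ->
  IZR ((Z.of_nat u - Z.of_nat v - 1) / Z.of_nat c) = INR ((u - v - 1) / c).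
Proof.
  intros H. rewrite INR_IZR_INZ, Nat2Z.inj_div. do 2 f_equal. lia.
Qed.

Lemma runs_scan_left P k s a v :
  is_dynamic_path P -> holds_data P k s -> (a <= v <= nedges P)%nat ->
  iv s 6 = Z.of_nat a -> iv s 7 = Z.of_nat v ->
  runs scan_left s (fun t s' =>
    (t <= 100 * (v - a + 1))%nat
    /\ is_ray (fun T => left_ok P a T (vpos P v)) (rv s' 5)).
Proof.
  intros HP HD Hav H6 H7. pose proof HP as (_ & _ & _ & Hcap).
  unfold scan_left. sim.
  apply runs_seq, runs_rset, runs_seq, runs_iset, runs_seq, runs_rset. sim.
  rewrite !H7.
  set (s1 := rset _ 5 _ _).
  assert (F1 : frame [8%nat] [4; 5]%nat s s1).
  { unfold s1. framed. }
  set (dom e i h := (e <= i <= h)%nat /\ (h < v)%nat).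
  set (bound i c := (vpos P v - vpos P i) * tau P
                    + INR ((psum P (S i) - psum P a - 1) / c)).
  eapply runs_while with
    (Inv := fun t s => holds_data P k s /\ iv s 6 = Z.of_nat a /\ rv s 4 = vpos P v
      /\ exists e, (a <= e <= v)%nat /\ iv s 7 = Z.of_nat e
      /\ (t <= 90 * (v - e))%nat
      /\ ((a < v)%nat -> exists c, (0 < c)%nat /\ iv s 8 = Z.of_nat c
            /\ (forall h, (e <= h < v)%nat -> (c <= cap P (S h))%nat)
            (* The alternative [S h = v] is for the start, when no edge has been passed but cell [8]
               already holds the capacity of edge [v]. *)
            /\ exists h, (a <= h < v)%nat /\ ((e <= h)%nat \/ S h = v) /\ c = cap P (S h))
      /\ forall T, rv s 5 <= T <-> 0 <= T /\ forall i h, dom e i h ->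
            (psum P a < psum P (S i))%nat -> bound i (cap P (S h)) <= T)
    (m := fun s => Z.to_nat (iv s 7)).
  - split; [apply (holds_data_frame P k [8%nat] [4; 5]%nat s s1); auto|].
    unfold s1; sim. split; [auto|]. split; [apply HD; lia|].
    exists v. repeat split; try lia; auto.
    + intros Hlt. exists (cap P v). repeat split.
      * apply Hcap; lia.
      * apply HD; lia.
      * intros; lia.
      * exists (v - 1)%nat. replace (S (v - 1)) with v by lia. repeat split; lia.
    + unfold dom; intros; lia.
    + tauto.
  - clear s HD H6 H7 s1 F1.
    intros t s (HD & H6 & H4 & e & He & H7 & Ht & Hc & HM) Hb.
    cbn in Hb. rewrite H6, H7 in Hb. apply Z.leb_le in Hb.
    destruct e as [|e]; [lia|].
    destruct (Hc ltac:(lia)) as (c & Hc0 & H8 & Hc1 & (h0 & Hh0 & Hh1 & Hh2)). clear Hc.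
    sim. apply runs_seq.
    eapply runs_impl; [apply runs_narrow|]. intros t1 s1 (Ht1 & F1 & E8).
    keep HD F1 HD1.
    destruct F1 as [FI FR].
    apply runs_seq, runs_iset, runs_seq, runs_iset. sim.
    rewrite !(FI 6%nat), !(FI 7%nat), !(FI 5%nat) by reflexivity.
    set (s2 := iset _ 7 _ _).
    assert (HD2 : holds_data P k s2).
    { apply (holds_data_frame P k [7; 9]%nat [] s1); auto.
      unfold s2. framed. }
    eapply runs_impl; [apply runs_relax; intros; reflexivity|].
    intros t2 s3 (Ht2 & F3 & HM3).
    keep HD2 F3 HD3.
    destruct F3 as [FI3 FR3].
    assert (G7 : iv s2 7 = Z.of_nat e) by (unfold s2; sim; rewrite H7; lia).
    assert (G4 : rv s2 4 = vpos P v) by (unfold s2; sim; rewrite FR; auto).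
    assert (G9 : iv s2 9 = (Z.of_nat (psum P (S e)) - Z.of_nat (psum P a))%Z).
    { unfold s2; sim. rewrite H6, H7.
      destruct HD as (_ & _ & _ & D5 & _). rewrite !D5 by lia. auto. }
    set (c' := Nat.min c (cap P (S e))).
    assert (G8 : iv s2 8 = Z.of_nat c').
    { unfold s2; sim. rewrite E8, H8, H7.
      destruct HD as (_ & _ & D3 & _). rewrite D3 by lia. lia. }
    assert (G5 : rv s2 5 = rv s 5) by (unfold s2; sim; rewrite FR; auto).
    split; [|rewrite FI3, G7, H7 by reflexivity; lia].
    split; [auto|]. split; [rewrite FI3 by reflexivity; unfold s2; sim; rewrite FI; auto|].
    split; [rewrite FR3; auto|].
    pose proof (Hcap (S e) ltac:(lia)) as Hce.
    assert (L1 : forall h, (e <= h < v)%nat -> (c' <= cap P (S h))%nat).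
    { intros h Hh. destruct (Nat.eq_dec h e) as [->|]; [lia|].
      specialize (Hc1 h ltac:(lia)). lia. }
    assert (L2 : exists h, (e <= h < v)%nat /\ c' = cap P (S h)).
    { destruct (le_gt_dec c (cap P (S e))) as [Hm|Hm].
      - exists h0. split; [lia|]. unfold c'; lia.
      - exists e. split; [lia|]. unfold c'; lia. }
    exists e. split; [lia|]. split; [rewrite FI3, G7; auto|].
    split; [cbn in Ht2; lia|]. split.
    + intros _. exists c'. split; [lia|]. split; [rewrite FI3, G8; auto|].
      split; auto. destruct L2 as (h & Hh & Eh). exists h. repeat split; auto; lia.
    + intros T. rewrite HM3, G5, (HM T), G9, G8. cbn [reval ieval RV V]. rewrite G4, G7.
      destruct HD2 as (_ & _ & _ & _ & D0 & D1). rewrite D0, D1 by lia.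
      assert (B : (psum P a < psum P (S e))%nat ->
        (vpos P v - vpos P e) * tau P
        + IZR ((Z.of_nat (psum P (S e)) - Z.of_nat (psum P a) - 1) / Z.of_nat c') <= T <->
        forall h, (e <= h < v)%nat -> bound e (cap P (S h)) <= T).
      { intros Hw. rewrite IZR_div_nat by auto.
        apply bottleneck with (cp := fun h => cap P (S h)); auto. lia. }
      split.
      * intros [[H0 HA] HB]. split; auto. intros i h [Hi Hh] Hw.
        destruct (Nat.eq_dec i e) as [->|]; [|apply HA; [split; lia | auto]].
        apply B; auto; [apply HB; lia | lia].
      * intros [H0 HA]. split; [split; [auto|]|].
        { intros i h [Hi Hh] Hw. apply HA; auto; split; lia. }
        intros Hw. apply B; [lia|]. intros h Hh. apply HA; [split; lia | lia].
  - clear s HD H6 H7 s1 F1.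
    intros t s (HD & H6 & H4 & e & He & H7 & Ht & _ & HM) Hb.
    cbn in Hb. rewrite H6, H7 in Hb. apply Z.leb_gt in Hb.
    assert (e = a) by lia; subst e. sim. split; [lia|].
    intros T. rewrite (HM T). unfold left_ok. split; intros [H0 H]; split; auto.
    + intros i h [Hi Hh] Hw. apply H; auto; try lia. apply vpos_lt; auto; lia.
    + intros i h Hi Hh Hx Hw. apply H; auto. split; auto.
      destruct (le_gt_dec v h); auto. pose proof (vpos_le P v h HP ltac:(lia)). lra.
Qed.

(** The alternative [y = vpos P v] serves the last vertex, where [vpos P (S v)] is arbitrary. *)
Lemma runs_scan_right P k s v b y :
  is_dynamic_path P -> holds_data P k s -> (v <= b <= nedges P)%nat ->
  vpos P v <= y < vpos P (S v) \/ y = vpos P v ->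
  iv s 6 = Z.of_nat b -> iv s 7 = Z.of_nat (S v) -> rv s 4 = y ->
  runs scan_right s (fun t s' =>
    (t <= 100 * (b - v + 1))%nat
    /\ is_ray (fun T => right_ok P b T y) (rv s' 5)).
Proof.
  intros HP HD Hvb Hy H6 H7 H4. pose proof HP as (_ & _ & _ & Hcap).
  unfold scan_right. sim.
  apply runs_seq, runs_iset, runs_seq, runs_rset. sim.
  rewrite !H7.
  set (s1 := rset _ 5 _ _).
  assert (F1 : frame [8%nat] [5%nat] s s1).
  { unfold s1. framed. }
  set (dom e h i := (v < h <= i)%nat /\ (i < e)%nat).
  set (bound i c := (vpos P i - y) * tau P
                    + INR ((psum P (S b) - psum P i - 1) / c)).
  eapply runs_while with
    (Inv := fun t s => holds_data P k s /\ iv s 6 = Z.of_nat b /\ rv s 4 = y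
      /\ exists e, (v < e <= S b)%nat /\ iv s 7 = Z.of_nat e
      /\ (t <= 90 * (e - S v))%nat
      /\ ((v < b)%nat -> exists c, (0 < c)%nat /\ iv s 8 = Z.of_nat c
            /\ (forall h, (v < h < e)%nat -> (c <= cap P h)%nat)
            /\ exists h, (v < h <= b)%nat /\ ((h < e)%nat \/ h = S v) /\ c = cap P h)
      /\ forall T, rv s 5 <= T <-> 0 <= T /\ forall h i, dom e h i ->
            (psum P i < psum P (S b))%nat -> bound i (cap P h) <= T)
    (m := fun s => Z.to_nat (iv s 6 + 1 - iv s 7)).
  - split; [apply (holds_data_frame P k [8%nat] [5%nat] s s1); auto|].
    unfold s1; sim. split; [auto|]. split; [auto|].
    exists (S v). repeat split; try lia; auto.
    + intros Hlt. exists (cap P (S v)). repeat split.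
      * apply Hcap; lia.
      * apply HD; lia.
      * intros; lia.
      * exists (S v). repeat split; lia.
    + unfold dom; intros; lia.
    + tauto.
  - clear s HD H6 H7 H4 s1 F1.
    intros t s (HD & H6 & H4 & e & He & H7 & Ht & Hc & HM) Hb.
    cbn in Hb. rewrite H6, H7 in Hb. apply Z.leb_le in Hb.
    destruct (Hc ltac:(lia)) as (c & Hc0 & H8 & Hc1 & (h0 & Hh0 & Hh1 & Hh2)). clear Hc.
    sim. apply runs_seq.
    eapply runs_impl; [apply runs_narrow|]. intros t1 s1 (Ht1 & F1 & E8).
    keep HD F1 HD1.
    destruct F1 as [FI FR].
    apply runs_seq, runs_iset, runs_seq. sim.
    rewrite !(FI 6%nat), !(FI 7%nat), !(FI 5%nat) by reflexivity.
    set (s2 := iset _ 9 _ _).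
    assert (HD2 : holds_data P k s2).
    { apply (holds_data_frame P k [9%nat] [] s1); auto.
      unfold s2. framed. }
    eapply runs_impl; [apply runs_relax; intros; reflexivity|].
    intros t2 s3 (Ht2 & F3 & HM3).
    keep HD2 F3 HD3.
    destruct F3 as [FI3 FR3].
    apply runs_iset. sim.
    set (s4 := iset _ 7 _ _).
    assert (HD4 : holds_data P k s4).
    { apply (holds_data_frame P k [7%nat] [] s3); auto.
      unfold s4. framed. }
    assert (G7 : iv s2 7 = Z.of_nat e) by (unfold s2; sim; rewrite FI; auto).
    assert (G4 : rv s2 4 = y) by (unfold s2; sim; rewrite FR; auto).
    assert (G9 : iv s2 9 = (Z.of_nat (psum P (S b)) - Z.of_nat (psum P e))%Z).
    { unfold s2; sim. rewrite H6, H7.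
      replace (Z.of_nat b + 1)%Z with (Z.of_nat (S b)) by lia.
      destruct HD as (_ & _ & _ & D5 & _). rewrite !D5 by lia. auto. }
    set (c' := Nat.min c (cap P e)).
    assert (G8 : iv s2 8 = Z.of_nat c').
    { unfold s2; sim. rewrite E8, H8, H7.
      destruct HD as (_ & _ & D3 & _). rewrite D3 by lia. lia. }
    assert (G5 : rv s2 5 = rv s 5) by (unfold s2; sim; rewrite FR; auto).
    assert (G6 : iv s2 6 = Z.of_nat b) by (unfold s2; sim; rewrite FI; auto).
    split; [|unfold s4; sim; rewrite !FI3, G7, G6, H6, H7 by reflexivity; lia].
    split; [exact HD4|].
    unfold s4; sim. rewrite !FI3, G7, G6 by reflexivity.
    split; [auto|]. split; [rewrite FR3; auto|].
    pose proof (Hcap e ltac:(lia)) as Hce.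
    assert (L1 : forall h, (v < h <= e)%nat -> (c' <= cap P h)%nat).
    { intros h Hh. destruct (Nat.eq_dec h e) as [->|]; [lia|].
      specialize (Hc1 h ltac:(lia)). lia. }
    assert (L2 : exists h, (v < h <= e)%nat /\ c' = cap P h).
    { destruct (le_gt_dec c (cap P e)) as [Hm|Hm].
      - exists h0. split; [lia|]. unfold c'; lia.
      - exists e. split; [lia|]. unfold c'; lia. }
    exists (S e). split; [lia|]. split; [lia|].
    split; [cbn in Ht2; lia|]. split.
    + intros _. exists c'. split; [lia|]. split; [rewrite G8; auto|].
      split; [intros; apply L1; lia|]. destruct L2 as (h & Hh & Eh).
      exists h. repeat split; auto; lia.
    + intros T. rewrite HM3, G5, (HM T), G9, G8. cbn [reval ieval RV V]. rewrite G4, G7.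
      destruct HD2 as (_ & _ & _ & _ & D0 & D1). rewrite D0, D1 by lia.
      assert (B : (psum P e < psum P (S b))%nat ->
        (vpos P e - y) * tau P
        + IZR ((Z.of_nat (psum P (S b)) - Z.of_nat (psum P e) - 1) / Z.of_nat c') <= T <->
        forall h, (v < h <= e)%nat -> bound e (cap P h) <= T).
      { intros Hw. rewrite IZR_div_nat by auto.
        apply bottleneck; auto. lia. }
      split.
      * intros [[H0 HA] HB]. split; auto. intros h i [Hi Hh] Hw.
        destruct (Nat.eq_dec i e) as [->|]; [|apply HA; [split; lia | auto]].
        apply B; auto; apply HB; lia.
      * intros [H0 HA]. split; [split; [auto|]|].
        { intros h i [Hi Hh] Hw. apply HA; auto; split; lia. }
        intros Hw. apply B; [lia|]. intros h Hh. apply HA; [split; lia | lia].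
  - clear s HD H6 H7 H4 s1 F1.
    intros t s (HD & H6 & H4 & e & He & H7 & Ht & _ & HM) Hb.
    cbn in Hb. rewrite H6, H7 in Hb. apply Z.leb_gt in Hb.
    assert (e = S b) by lia; subst e. sim. split; [lia|].
    intros T. rewrite (HM T). unfold right_ok. split; intros [H0 H]; split; auto.
    + intros h i [Hi Hh] Hw. apply H; auto; try lia.
      pose proof (vpos_le P (S v) h HP ltac:(lia)).
      pose proof (vpos_lt P v (S v) HP ltac:(lia)). lra.
    + intros h i Hi Hx Hw. apply H; auto. split; [|lia].
      destruct (le_gt_dec h v); [|lia]. pose proof (vpos_le P h v HP ltac:(lia)). lra.
Qed.

(** * Searches *)

(* Hides disequalities of cell names from [lia], which would split on them. *)
Definition apart (a b : nat) : Prop := a <> b.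

Lemma apart_sym a b : apart a b -> apart b a.
Proof. intros H E; apply H; auto. Qed.

#[local] Hint Immediate apart_sym : core.

Lemma iv_iset_eq s a v : iv (iset s a 0 v) a = v.
Proof. cbn. unfold update. rewrite Nat.eqb_refl. reflexivity. Qed.

Lemma iv_iset_ne s a b z y v : b <> a -> ints (iset s a z v) b y = ints s b y.
Proof.
  intros H. cbn. unfold update. destruct (Nat.eqb_spec b a) as [->|]; [|reflexivity].
  exfalso; apply H; reflexivity.
Qed.

Lemma mem_cons a b l : mem a (b :: l) = false <-> apart a b /\ mem a l = false.
Proof.
  unfold mem; cbn. rewrite Bool.orb_false_iff, Nat.eqb_neq. reflexivity.
Qed.

Lemma mem_cons_eq a b l : a = b \/ mem a l = true -> mem a (b :: l) = true.
Proof.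
  unfold mem; cbn. intros [->|H]; [rewrite Nat.eqb_refl; auto | rewrite H].
  apply Bool.orb_true_r.
Qed.

Definition bsearch (lo hi mid flag : nat) (test : com) : com :=
  While (ILe (IAdd (V lo) (IConst 2)) (V hi))
    (block
      [iassign mid (IDiv (IAdd (V lo) (V hi)) (IConst 2));
       test;
       If (ILe (IConst 1) (V flag)) (iassign lo (V mid)) (iassign hi (V mid))]).

(** The ends [l0] and [h0] are sentinels that are never tested. The result is a place where [Pr]
    switches from true to false, up to sentinels; callers derive the rest from monotonicity of their
    own predicates. *)
Lemma runs_bsearch lo hi mid flag test (Pr : Z -> Prop) (l0 h0 : Z) (K L : nat) s0 :
  apart lo hi -> apart mid lo -> apart mid hi ->
  mem lo (imods test) = false -> mem hi (imods test) = false ->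
  mem mid (imods test) = false ->
  iv s0 lo = l0 -> iv s0 hi = h0 -> (l0 < h0 <= l0 + 2 ^ Z.of_nat L)%Z ->
  (forall s, frame (lo :: hi :: mid :: imods test) (rmods test) s0 s ->
     (l0 < iv s mid < h0)%Z ->
     runs test s (fun t s' => (t <= K)%nat /\ ((1 <= iv s' flag)%Z <-> Pr (iv s mid)))) ->
  runs (bsearch lo hi mid flag test) s0 (fun t s' =>
    (t <= L * (K + 40) + 40)%nat
    /\ frame (lo :: hi :: mid :: imods test) (rmods test) s0 s'
    /\ exists x, iv s' lo = x /\ iv s' hi = (x + 1)%Z /\ (l0 <= x < h0)%Z
       /\ (x = l0 \/ Pr x) /\ ((x + 1)%Z = h0 \/ ~ Pr (x + 1)%Z)).
Proof.
  intros N1 N2 N3 M1 M2 M3 Elo Ehi HL Ht.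
  unfold bsearch.
  set (fr := frame (lo :: hi :: mid :: imods test) (rmods test)) in *.
  eapply runs_while with
    (Inv := fun t s => fr s0 s /\ exists q, (q <= L)%nat
       /\ (iv s lo < iv s hi <= iv s lo + 2 ^ Z.of_nat q)%Z
       /\ (t + q * (K + 40) <= L * (K + 40))%nat
       /\ (l0 <= iv s lo)%Z /\ (iv s hi <= h0)%Z
       /\ (iv s lo = l0 \/ Pr (iv s lo)) /\ (iv s hi = h0 \/ ~ Pr (iv s hi)))
    (m := fun s => Z.to_nat (iv s hi - iv s lo)).
  - split; [apply frame_refl|]. exists L. rewrite Elo, Ehi. repeat split; auto; try lia.
  - clear Elo Ehi HL. intros t s (F & q & Hq & Hr & Hc & B1 & B2 & P1 & P2) Hb.
    cbn in Hb. apply Z.leb_le in Hb.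
    destruct q as [|q]; [cbn in Hr; lia|].
    rewrite Nat2Z.inj_succ, Z.pow_succ_r in Hr by lia.
    cbn [block]. apply runs_seq, runs_iset. cbn [ieval V icost].
    set (c := ((iv s lo + iv s hi) / 2)%Z).
    assert (Hc1 : (2 * c <= iv s lo + iv s hi < 2 * c + 2)%Z).
    { unfold c. pose proof (Z.div_mod (iv s lo + iv s hi) 2).
      pose proof (Z.mod_pos_bound (iv s lo + iv s hi) 2). lia. }
    apply runs_seq. eapply runs_impl.
    { apply runs_frame, Ht.
      - eapply frame_trans; [exact F|]. eapply frame_iset; [|apply frame_refl].
        apply mem_cons_eq; right; apply mem_cons_eq; right; apply mem_cons_eq; auto.
      - rewrite iv_iset_eq. lia. }
    intros t1 s1 [(Ht1 & Hflag) F1]. rewrite iv_iset_eq in Hflag.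
    assert (F' : fr s0 s1).
    { eapply frame_trans; [exact F|]. eapply frame_iset;
        [|eapply frame_incl, F1]; auto.
      - apply mem_cons_eq; right; apply mem_cons_eq; right; apply mem_cons_eq; auto.
      - intros a Ha. rewrite !mem_cons in Ha. tauto. }
    assert (Elo : iv s1 lo = iv s lo).
    { rewrite (proj1 F1) by auto. apply iv_iset_ne; auto. }
    assert (Ehi : iv s1 hi = iv s hi).
    { rewrite (proj1 F1) by auto. apply iv_iset_ne; auto. }
    assert (Emid : iv s1 mid = c).
    { rewrite (proj1 F1) by auto. apply iv_iset_eq; auto. }
    apply runs_if. cbn [beval ieval V bcost icost].
    destruct (Z.leb_spec 1 (iv s1 flag)) as [H|H].
    + apply runs_iset. cbn [ieval V icost].
      split; [split|].
      * eapply frame_trans; [exact F'|]. eapply frame_iset; [|apply frame_refl].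
        apply mem_cons_eq; auto.
      * exists q. rewrite iv_iset_eq, iv_iset_ne, Ehi, Emid by auto.
        cbn [bcost icost V] in *. repeat split; try lia; auto. right; apply Hflag; auto.
      * rewrite iv_iset_eq, iv_iset_ne, Ehi, Emid by auto. lia.
    + apply runs_iset. cbn [ieval V icost].
      split; [split|].
      * eapply frame_trans; [exact F'|]. eapply frame_iset; [|apply frame_refl].
        apply mem_cons_eq; right; apply mem_cons_eq; auto.
      * exists q. rewrite iv_iset_eq, iv_iset_ne, Elo, Emid by auto.
        cbn [bcost icost V] in *. repeat split; try lia; auto. right. rewrite <- Hflag. lia.
      * rewrite iv_iset_eq, iv_iset_ne, Elo, Emid by auto. lia.
  - intros t s (F & q & Hq & Hr & Hc & B1 & B2 & P1 & P2) Hb.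
    cbn in Hb. apply Z.leb_gt in Hb. cbn [bcost icost V].
    split.
    { assert (t <= L * (K + 40))%nat; [|lia].
      eapply Nat.le_trans, Hc. apply Nat.le_add_r. }
    split; [auto|].
    assert (E : iv s hi = (iv s lo + 1)%Z) by lia.
    exists (iv s lo). rewrite <- E. repeat split; auto; lia.
Qed.

(* Doubling search for the last index up to [lim] where the test succeeds,
   starting from [org]; its cost is proportional to the distance travelled. *)
Definition gallop (org lim lo hi mid flag : nat) (test : com) : com :=
  block
    [iassign lo (V org); iassign hi (IAdd (V org) (IConst 1)); iassign flag (IConst 1);
     While (ILe (IConst 1) (V flag))
       (If (ILe (V hi) (V lim))
         (block
           [iassign mid (V hi); test;
            If (ILe (IConst 1) (V flag))
              (block [iassign lo (V hi);
                      iassign hi (IAdd (V hi) (ISub (V hi) (V org)))])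
              Skip])
         (block [iassign hi (IAdd (V lim) (IConst 1)); iassign flag (IConst 0)]));
     bsearch lo hi mid flag test].

Lemma runs_gallop org lim lo hi mid flag test (Pr : nat -> Prop) (o l K L : nat) s0 :
  NoDup [org; lim; lo; hi; mid; flag] ->
  mem org (imods test) = false -> mem lim (imods test) = false ->
  mem lo (imods test) = false -> mem hi (imods test) = false ->
  mem mid (imods test) = false ->
  iv s0 org = Z.of_nat o -> iv s0 lim = Z.of_nat l -> (o <= l)%nat ->
  (l < 2 ^ L)%nat ->
  (forall s m, frame (lo :: hi :: mid :: flag :: imods test) (rmods test) s0 s ->
     iv s mid = Z.of_nat m -> (o < m <= l)%nat ->
     runs test s (fun t s' => (t <= K * (m - o + 1))%nat
                              /\ ((1 <= iv s' flag)%Z <-> Pr m))) ->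
  runs (gallop org lim lo hi mid flag test) s0 (fun t s' =>
    exists u, iv s' lo = Z.of_nat u /\ (o <= u <= l)%nat
       /\ (u = o \/ Pr u) /\ (u = l \/ ~ Pr (S u))
       /\ (t <= (2 * L + 3) * (2 * K + 100) * (u - o + 1))%nat).
Proof.
  intros ND M1 M2 M3 M4 M5 Eorg Elim Hol HL Ht.
  assert (NE : apart org lim /\ apart org lo /\ apart org hi /\ apart org mid /\ apart org flag /\
               apart lim lo /\ apart lim hi /\ apart lim mid /\ apart lim flag /\
               apart lo hi /\ apart lo mid /\ apart lo flag /\ apart hi mid /\ apart hi flag /\
               apart mid flag).
  { repeat match goal with H : NoDup (_ :: _) |- _ =>
      apply NoDup_cons_iff in H; destruct H as [? H]; cbn in * end.
    repeat split; intros ->; tauto. }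
  clear ND. destruct NE as (n1&n2&n3&n4&n5&n6&n7&n8&n9&n10&n11&n12&n13&n14&n15).
  set (li := lo :: hi :: mid :: flag :: imods test) in *.
  set (fr := frame li (rmods test)) in *.
  assert (Mlo : mem lo li = true) by (apply mem_cons_eq; auto).
  assert (Mhi : mem hi li = true) by (do 2 (apply mem_cons_eq; auto; right)).
  assert (Mmid : mem mid li = true) by (do 3 (apply mem_cons_eq; auto; right)).
  assert (Mflag : mem flag li = true) by (do 4 (apply mem_cons_eq; auto; right)).
  assert (Morg : mem org li = false) by (unfold li; rewrite !mem_cons; auto).
  assert (Mlim : mem lim li = false) by (unfold li; rewrite !mem_cons; auto 10).
  assert (Mi : forall a, mem a li = false -> mem a (imods test) = false)
    by (intros a; unfold li; rewrite !mem_cons; tauto).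
  (* The cost of one round when the last success is at distance [u]: tests then reach no further
     than distance [2 * u + 1]. *)
  set (U := fun u => (K * (2 * u + 2) + 60)%nat).
  assert (Umono : forall u u', (u <= u')%nat -> (U u <= U u')%nat)
    by (intros; unfold U; apply Nat.add_le_mono_r, Nat.mul_le_mono_l; lia).
  unfold gallop. cbn [block].
  apply runs_seq, runs_iset, runs_seq, runs_iset, runs_seq, runs_iset.
  cbn [ieval V icost]. rewrite (iv_iset_ne _ lo org), Eorg by auto.
  set (s1 := iset _ flag 0 _).
  assert (F1 : fr s0 s1).
  { unfold s1. eapply frame_iset; [exact Mlo|]. eapply frame_iset; [exact Mhi|].
    eapply frame_iset; [exact Mflag|]. apply frame_refl. }
  apply runs_seq.
  eapply runs_while with
    (Inv := fun t s => fr s0 s /\ exists u,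
       iv s lo = Z.of_nat (o + u) /\ (o + u <= l)%nat /\ (u = 0%nat \/ Pr (o + u)%nat)
       (* Either the doubling goes on, or it has stopped with [hi] at a failure or just past the
          limit. In both cases [hi] is within [2 * u + 1] of the origin, which ties the cost to the
          answer and not to the limit. *)
       /\ (((1 <= iv s flag)%Z /\ exists q, iv s hi = Z.of_nat (o + 2 ^ q) /\ (q <= L)%nat
            /\ (u < 2 ^ q <= 2 * u + 1)%nat /\ (t <= q * U u)%nat)
          \/ ((iv s flag < 1)%Z /\ exists w, iv s hi = Z.of_nat (o + w)
            /\ (u < w <= 2 * u + 1)%nat /\ (o + w <= S l)%nat
            /\ (o + w = S l \/ ~ Pr (o + w))%nat /\ (t <= (L + 1) * U u)%nat)))
    (m := fun s => if (1 <=? iv s flag)%Z then S (Z.to_nat (Z.of_nat l + 1 - iv s hi))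
                   else 0%nat).
  - split; [exact F1|]. exists 0%nat. unfold s1.
    rewrite !iv_iset_eq, !(iv_iset_ne _ flag) by auto.
    rewrite !iv_iset_eq, (iv_iset_ne _ hi lo), iv_iset_eq by auto.
    split; [f_equal; lia|]. split; [lia|]. split; [left; auto|].
    left; split; [lia|].
    exists 0%nat. change (2 ^ 0)%nat with 1%nat.
    split; [lia|]. split; [lia|]. split; lia.
  - clear s1 F1. intros t s (F & u & Hlo & Hul & HP & Hm) Hb.
    cbn in Hb. apply Z.leb_le in Hb.
    destruct Hm as [(Hf & q & Hhi & Hq & Huq & Htq)|(Hf & _)]; [|lia].
    apply runs_if. cbn [beval ieval V bcost icost].
    assert (Lorg : iv s org = Z.of_nat o) by (rewrite (proj1 F); auto).
    assert (Llim : iv s lim = Z.of_nat l) by (rewrite (proj1 F); auto).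
    rewrite Hhi, Llim.
    destruct (Z.leb_spec (Z.of_nat (o + 2 ^ q)) (Z.of_nat l)) as [Hle|Hgt].
    + assert (HqL : (q < L)%nat) by (apply (Nat.pow_lt_mono_r_iff 2); lia).
      cbn [block]. apply runs_seq, runs_iset. cbn [ieval V icost]. rewrite Hhi.
      apply runs_seq. eapply runs_impl.
      { apply runs_frame, (Ht _ (o + 2 ^ q)%nat).
        - eapply frame_trans; [exact F|]. eapply frame_iset; [exact Mmid|].
          apply frame_refl.
        - apply iv_iset_eq.
        - lia. }
      intros t1 s1 [(Ht1 & Hflag) F1].
      assert (F' : fr s0 s1).
      { eapply frame_trans; [exact F|]. eapply frame_iset; [exact Mmid|].
        eapply frame_incl, F1; auto. }
      assert (Glo : iv s1 lo = Z.of_nat (o + u)).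
      { rewrite (proj1 F1), iv_iset_ne by auto. auto. }
      assert (Ghi : iv s1 hi = Z.of_nat (o + 2 ^ q)).
      { rewrite (proj1 F1), iv_iset_ne by auto. auto. }
      assert (Gorg : iv s1 org = Z.of_nat o) by (rewrite (proj1 F'); auto).
      assert (C1 : (t1 <= K * (2 * u + 2))%nat) by nia.
      apply runs_if. cbn [beval ieval V bcost icost].
      destruct (Z.leb_spec 1 (iv s1 flag)) as [H|H].
      * cbn [block]. apply runs_seq, runs_iset, runs_iset. cbn [ieval V icost].
        rewrite !(iv_iset_ne _ lo) by auto. rewrite Ghi, Gorg.
        split; [split|].
        -- eapply frame_trans; [exact F'|]. eapply frame_iset; [exact Mlo|].
           eapply frame_iset; [exact Mhi|]. apply frame_refl.
        -- exists (2 ^ q)%nat.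
           rewrite !(iv_iset_ne _ hi) by auto. rewrite !iv_iset_eq.
           rewrite !(iv_iset_ne _ lo) by auto.
           split; [auto|]. split; [lia|]. split; [right; apply Hflag; auto|].
           left. split; auto. exists (S q). rewrite Nat.pow_succ_r'.
           cbn [bcost icost V].
           repeat split; try lia.
           pose proof (Umono u (2 ^ q)%nat ltac:(lia)).
           cbn [Nat.mul]. unfold U in *. nia.
        -- rewrite !(iv_iset_ne _ hi), !(iv_iset_ne _ lo), iv_iset_eq by auto.
           rewrite (proj2 (Z.leb_le _ _) H), (proj2 (Z.leb_le _ _) Hf), ?Hhi.
           lia.
      * apply runs_skip. split; [split; [exact F'|]|].
        -- exists u. rewrite Glo, Ghi. repeat split; auto. right. split; [lia|].
           exists (2 ^ q)%nat. cbn [bcost icost V].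
           repeat split; auto; try lia.
           ++ right. rewrite <- Hflag. lia.
           ++ assert (q * U u <= L * U u)%nat by (apply Nat.mul_le_mono_r; lia).
              unfold U in *. nia.
        -- rewrite (proj2 (Z.leb_gt _ _) H), (proj2 (Z.leb_le _ _) Hf). lia.
    + cbn [block]. apply runs_seq, runs_iset, runs_iset. cbn [ieval V icost].
      rewrite !(iv_iset_ne _ flag) by auto.
      split; [split|].
      * eapply frame_trans; [exact F|]. eapply frame_iset; [exact Mhi|].
        eapply frame_iset; [exact Mflag|]. apply frame_refl.
      * exists u. rewrite iv_iset_eq, !(iv_iset_ne _ flag), iv_iset_eq by auto.
        rewrite !(iv_iset_ne _ hi) by auto. repeat split; auto. right.
        split; [lia|]. exists (S l - o)%nat. cbn [bcost icost V].
        rewrite Llim. repeat split; try lia.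
        assert (q * U u <= L * U u)%nat by (apply Nat.mul_le_mono_r; lia).
        unfold U in *. nia.
      * rewrite iv_iset_eq, (proj2 (Z.leb_le _ _) Hf). cbn. lia.
  - clear s1 F1. intros t s (F & u & Hlo & Hul & HP & Hm) Hb.
    cbn in Hb. apply Z.leb_gt in Hb. cbn [bcost icost V].
    destruct Hm as [(Hf & _)|(_ & w & Hhi & Huw & Hwl & HPw & Htu)]; [lia|].
    eapply runs_impl.
    { apply (runs_bsearch lo hi mid flag test (fun z => Pr (Z.to_nat z))
               (Z.of_nat (o + u)) (Z.of_nat (o + w)) (K * (2 * u + 2)) L); auto.
      - split; [lia|]. apply (inj_lt l) in HL. rewrite Nat2Z.inj_pow in HL. lia.
      - intros s2 F2 Hmid.
        assert (E2 : iv s2 mid = Z.of_nat (Z.to_nat (iv s2 mid))) by lia.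
        eapply runs_impl; [apply (Ht s2 (Z.to_nat (iv s2 mid)))|]; auto.
        + eapply frame_trans; [exact F|]. eapply frame_incl, F2; auto.
          intros a. unfold li. rewrite !mem_cons. tauto.
        + lia.
        + intros t1 s3 [Ht1 Hflag]. split; auto. nia. }
    intros t1 s2 (Ht1 & _ & x & Elo & _ & Hx & Px & Px').
    exists (Z.to_nat x). rewrite Elo. repeat split; try lia.
    + destruct Px as [->|Px]; [|auto]. rewrite Nat2Z.id.
      destruct HP as [->|HP]; [left; lia | auto].
    + assert (E : Z.to_nat (x + 1) = S (Z.to_nat x)) by lia. rewrite E in Px'.
      destruct Px' as [Ex|Px']; [|auto].
      destruct HPw as [E'|HPw]; [left; lia|].
      right. replace (S (Z.to_nat x)) with (o + w)%nat by lia. auto.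
    + assert (Hxu : (u <= Z.to_nat x - o)%nat) by lia.
      set (d := (Z.to_nat x - o)%nat) in *.
      unfold U in *.
      transitivity ((2 * L + 3) * (K * (2 * u + 2) + 80))%nat; [nia|].
      rewrite <- Nat.mul_assoc. apply Nat.mul_le_mono_l. nia.
Qed.

(** * The optimal sink of a part *)

Lemma is_ray_unique U M M' : is_ray U M -> is_ray U M' -> M = M'.
Proof.
  intros H H'. apply Rle_antisym; [apply H, H' | apply H', H]; lra.
Qed.

(* The part is [10 .. 11] and the sink is the vertex in [14]; the left time is
   put in real cell [7] and the right time in [5]. *)
Definition sides : com :=
  block
    [iassign 6 (V 10); iassign 7 (V 14); scan_left; rassign 7 (RV 5);
     iassign 6 (V 11); iassign 7 (IAdd (V 14) (IConst 1)); rassign 4 (RGet 1 (V 14));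
     scan_right].

Lemma runs_sides P k s a b v :
  is_dynamic_path P -> holds_data P k s -> (a <= v <= b)%nat -> (b <= nedges P)%nat ->
  iv s 10 = Z.of_nat a -> iv s 11 = Z.of_nat b -> iv s 14 = Z.of_nat v ->
  runs sides s (fun t s' => (t <= 300 * S (nedges P))%nat
    /\ is_ray (fun T => left_ok P a T (vpos P v)) (rv s' 7)
    /\ is_ray (fun T => right_ok P b T (vpos P v)) (rv s' 5)).
Proof.
  intros HP HD Hv Hb H10 H11 H14. unfold sides. cbn [block].
  apply runs_seq, runs_iset, runs_seq, runs_iset, runs_seq.
  set (s0 := iset _ 7 _ _).
  assert (HD0 : holds_data P k s0) by exact HD.
  eapply runs_impl.
  { apply runs_frame, (runs_scan_left P k s0 a v); auto; lia. }
  intros t1 s1 [[Ht1 R1] F]. keep HD0 F HD1. destruct F as [FI FR].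
  apply runs_seq, runs_rset, runs_seq, runs_iset, runs_seq, runs_iset, runs_seq, runs_rset.
  sim. rewrite !FI by reflexivity. unfold s0. sim. rewrite H11, H14.
  eapply runs_impl.
  { apply runs_frame, (runs_scan_right P k _ v b (vpos P v)); auto; try lia; sim; try lia.
    apply HD1; lia. }
  intros t2 s2 [[Ht2 R2] [FI2 FR2]]. sim.
  split; [lia|]. split; auto.
  rewrite FR2 by reflexivity. sim. auto.
Qed.

Definition balance_test : com :=
  block [sides; If (RLe (RV 5) (RV 7)) (iassign 15 (IConst 0)) (iassign 15 (IConst 1))].

(** Finds the first vertex whose left time is at least its right time. The right time at [b] is [0],
    so [b] can be a sentinel. If the search ends at [a] itself, both times there are [0] and so is
    the optimum. *)
Definition eval_one_sink : com :=
  block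
    [iassign 12 (ISub (V 10) (IConst 1)); iassign 13 (V 11);
     bsearch 12 13 14 15 balance_test;
     If (ILe (V 13) (V 10))
       (rassign 8 (ROfInt (IConst 0)))
       (block
         [iassign 14 (V 13); sides; rassign 8 (RV 7);
          iassign 14 (V 12); sides;
          rassign 7 (RDiv (RSub (RAdd (RV 8) (RV 5))
                       (RMul (RSub (RGet 1 (V 13)) (RGet 1 (V 12))) (RV 0)))
                     (ROfInt (IConst 2)));
          If (RLe (RV 5) (RV 7)) (rassign 7 (RV 5)) Skip;
          If (RLe (RV 7) (RV 8)) (rassign 8 (RV 7)) Skip])].

Lemma runs_eval_one_sink P k s a b L :
  is_dynamic_path P -> holds_data P k s -> (a <= b <= nedges P)%nat ->
  (S (nedges P) <= 2 ^ L)%nat ->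
  iv s 10 = Z.of_nat a -> iv s 11 = Z.of_nat b ->
  runs eval_one_sink s (fun t s' => (t <= (100 * 10) * (L + 1) * S (nedges P))%nat
    /\ is_ray (one_sink P a b) (rv s' 8)).
Proof.
  intros HP HD Hab HL H10 H11. unfold eval_one_sink. cbn [block].
  apply runs_seq, runs_iset, runs_seq, runs_iset. sim. rewrite H10, H11.
  set (s0 := iset _ 13 0 _).
  assert (F0 : frame [12; 13]%nat [] s s0) by (unfold s0; framed).
  keep HD F0 HD0.
  (* Stated through rays, hence independent of the store in which the test is run. *)
  set (Pr z := exists ML MR,
         is_ray (fun T => left_ok P a T (vpos P (Z.to_nat z))) ML
         /\ is_ray (fun T => right_ok P b T (vpos P (Z.to_nat z))) MR /\ ML < MR).
  apply runs_seq. eapply runs_impl.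
  { apply (runs_bsearch 12 13 14 15 balance_test Pr (Z.of_nat a - 1) (Z.of_nat b)
             (400 * S (nedges P)) L s0); try reflexivity; try discriminate.
    - apply inj_le in HL. rewrite Nat2Z.inj_pow in HL. lia.
    - intros s1 F1 Hmid. keep HD0 F1 HD1.
      unfold balance_test. cbn [block]. apply runs_seq.
      eapply runs_impl.
      { apply (runs_sides P k s1 a b (Z.to_nat (iv s1 14))); auto; try lia.
        - rewrite (proj1 F1) by reflexivity. unfold s0; sim; auto.
        - rewrite (proj1 F1) by reflexivity. unfold s0; sim; auto. }
      intros t2 s2 (Ht2 & RL & RR).
      assert (HPr : Pr (iv s1 14) <-> rv s2 7 < rv s2 5).
      { split.
        - intros (ML & MR & H1 & H2 & H3).
          rewrite (is_ray_unique _ _ _ RL H1), (is_ray_unique _ _ _ RR H2). auto.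
        - intros H; exists (rv s2 7), (rv s2 5); auto. }
      apply runs_if. sim. destruct (Rle_dec (rv s2 5) (rv s2 7)) as [H|H];
        apply runs_iset; sim; (split; [lia|]); rewrite HPr; split; intros;
          try lra; lia. }
  intros t1 s1 (Ht1 & F1 & x & E12 & E13 & Hx & HPx & HPx').
  keep HD0 F1 HD1.
  assert (G10 : iv s1 10 = Z.of_nat a)
    by (rewrite (proj1 F1) by reflexivity; unfold s0; sim; auto).
  assert (G11 : iv s1 11 = Z.of_nat b)
    by (rewrite (proj1 F1) by reflexivity; unfold s0; sim; auto).
  apply runs_if. sim. rewrite E13, G10.
  assert (Ray : forall v, (a <= v <= b)%nat -> (v = b \/ ~ Pr (Z.of_nat v)) ->
            forall A R, is_ray (fun T => left_ok P a T (vpos P v)) A ->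
            is_ray (fun T => right_ok P b T (vpos P v)) R -> R <= A).
  { intros v Hv [->|HN] A R HA HR.
    - apply HR, right_ok_end; auto; try lia; try lra. apply (proj2 (HA A)); lra.
    - destruct (Rle_lt_dec R A); auto. exfalso; apply HN.
      exists A, R. rewrite Nat2Z.id. auto. }
  destruct (Z.leb_spec (x + 1) (Z.of_nat a)) as [Hxa|Hxa].
  - apply runs_rset. sim. split; [nia|].
    destruct (right_ray P b (vpos P a)) as [R HR].
    destruct (left_ray P a (vpos P a)) as [A HA].
    assert (A <= 0) by (apply HA, left_ok_start; auto; lra).
    replace (x + 1)%Z with (Z.of_nat a) in HPx' by lia.
    assert (R <= A).
    { apply (Ray a); auto; try lia. destruct HPx'; [left; lia | auto]. }
    apply (one_sink_value_start P a b R); auto. lra.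
  - cbn [block]. apply runs_seq, runs_iset. sim. rewrite E13.
    set (v := Z.to_nat x).
    assert (Ev : x = Z.of_nat v) by lia.
    replace (x + 1)%Z with (Z.of_nat (S v)) in * by lia.
    set (s2 := iset _ 14 0 _).
    assert (F2 : frame [14%nat] [] s1 s2) by (unfold s2; framed).
    keep HD1 F2 HD2.
    apply runs_seq. eapply runs_impl.
    { apply runs_frame, (runs_sides P k s2 a b (S v)); auto; try lia. }
    intros t3 s3 [(Ht3 & RA & RRv) F3].
    keep HD2 F3 HD3.
    apply runs_seq, runs_rset, runs_seq, runs_iset. sim.
    rewrite (proj1 F3) by reflexivity. replace (iv s2 12) with x by (unfold s2; sim; auto).
    set (s4 := iset _ 14 0 _).
    assert (F4 : frame [14%nat] [8%nat] s3 s4) by (unfold s4; framed).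
    keep HD3 F4 HD4.
    apply runs_seq. eapply runs_impl.
    { apply runs_frame, (runs_sides P k s4 a b v); auto; try lia;
      unfold s4; sim; try (rewrite (proj1 F3) by reflexivity; unfold s2; sim; auto). }
    intros t5 s5 [(Ht5 & RLu & RB) F5].
    keep HD4 F5 HD5.
    assert (V12 : iv s5 12 = Z.of_nat v).
    { rewrite (proj1 F5) by reflexivity. unfold s4; sim.
      rewrite (proj1 F3) by reflexivity. unfold s2; sim. lia. }
    assert (V13 : iv s5 13 = Z.of_nat (S v)).
    { rewrite (proj1 F5) by reflexivity. unfold s4; sim.
      rewrite (proj1 F3) by reflexivity. unfold s2; sim. auto. }
    assert (V8 : rv s5 8 = rv s3 7).
    { rewrite (proj2 F5) by reflexivity. unfold s4; sim. auto. }
    assert (H1 : rv s3 5 <= rv s3 7).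
    { apply (Ray (S v)); auto; try lia. destruct HPx'; [left; lia | auto]. }
    assert (H2 : rv s5 7 < rv s5 5).
    { destruct HPx as [HPx|(ML & MR & G1 & G2 & G3)]; [lia|].
      fold v in G1, G2.
      rewrite (is_ray_unique _ _ _ RLu G1), (is_ray_unique _ _ _ RB G2). auto. }
    pose proof (one_sink_value P a b v _ _ _ _ HP ltac:(lia) ltac:(lia)
                  RA RRv RLu RB H1 H2) as HV.
    apply runs_seq, runs_rset. sim. rewrite V12, V13, V8.
    destruct HD5 as (_ & _ & _ & _ & D0 & D1). rewrite D0, !D1 by lia.
    set (m := (rv s3 7 + rv s5 5 - (vpos P (S v) - vpos P v) * tau P) / 2) in *.
    assert (Hc : (300 + L * (400 * S (nedges P) + 40) + 40 + 700 * S (nedges P)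
                  <= (100 * 10) * (L + 1) * S (nedges P) + 300)%nat) by nia.
    apply runs_seq, runs_if. sim.
    destruct (Rle_dec (rv s5 5) m) as [Hm|Hm];
      [apply runs_rset | apply runs_skip]; sim; apply runs_if; sim; rewrite V8;
      (destruct (Rle_dec _ (rv s3 7)) as [Hm'|Hm'];
       [apply runs_rset | apply runs_skip]; sim; (split; [lia|]));
      rewrite ?V8;
      match goal with
      | |- is_ray _ ?z => cut (Rmin (rv s3 7) (Rmin (rv s5 5) m) = z); [intros <-; exact HV|]
      end;
      unfold Rmin; repeat destruct Rle_dec; lra.
Qed.

(** * Greedy decision *)

(* The part starts at [16] and may extend up to [18]; [19] becomes the last
   vertex that is an admissible sink for the left side, [23] the last vertex of
   the part.  Real cells: [9] time bound, [10] sink. *)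
Definition left_test : com :=
  block
    [iassign 6 (V 16); iassign 7 (V 21); scan_left;
     If (RLe (RV 5) (RV 9)) (iassign 22 (IConst 1)) (iassign 22 (IConst 0))].

Definition right_test : com :=
  block
    [iassign 6 (V 25); iassign 7 (IAdd (V 19) (IConst 1)); rassign 4 (RV 10); scan_right;
     If (RLe (RV 5) (RV 9)) (iassign 26 (IConst 1)) (iassign 26 (IConst 0))].

(** Computes the point of [left_ok_rightmost], except that at the limit [18] the sink stays on the
    vertex, since the part can extend no further. *)
Definition place_sink : com :=
  block
    [rassign 10 (RGet 1 (V 19));
     If (ILe (IAdd (V 19) (IConst 1)) (V 18))
       (block
         [iassign 6 (V 16); iassign 7 (IAdd (V 19) (IConst 1)); scan_left;
          rassign 4 (RSub (RGet 1 (IAdd (V 19) (IConst 1)))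
                       (RDiv (RSub (RV 5) (RV 9)) (RV 0)));
          If (RLe (RV 10) (RV 4)) (rassign 10 (RV 4)) Skip])
       Skip].

(* A sink beyond the last vertex of the part is moved back to it. *)
Definition next_part : com :=
  block
    [gallop 16 18 19 20 21 22 left_test;
     place_sink;
     gallop 19 18 23 24 25 26 right_test;
     If (ILe (V 23) (V 19)) (rassign 10 (RGet 1 (V 19))) Skip].

Lemma runs_left_test P k s T a m :
  is_dynamic_path P -> holds_data P k s -> (a <= m <= nedges P)%nat ->
  iv s 16 = Z.of_nat a -> iv s 21 = Z.of_nat m -> rv s 9 = T ->
  runs left_test s (fun t s' => (t <= 150 * (m - a + 1))%nat
    /\ ((1 <= iv s' 22)%Z <-> left_ok P a T (vpos P m))).
Proof.
  intros HP HD Ham H16 H21 H9. unfold left_test. cbn [block].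
  apply runs_seq, runs_iset, runs_seq, runs_iset, runs_seq. sim.
  eapply runs_impl.
  { apply runs_frame, (runs_scan_left P k _ a m); auto; lia. }
  intros t1 s1 [[Ht1 R1] [_ FR]]. apply runs_if. sim.
  rewrite (FR 9%nat) by reflexivity. sim. rewrite H9.
  destruct (Rle_dec (rv s1 5) T); apply runs_iset; sim;
    (split; [lia|]); rewrite (R1 T); split; intros; auto; lia || contradiction.
Qed.

Lemma runs_right_test P k s T y v m :
  is_dynamic_path P -> holds_data P k s -> (v <= m <= nedges P)%nat ->
  vpos P v <= y < vpos P (S v) \/ y = vpos P v ->
  iv s 19 = Z.of_nat v -> iv s 25 = Z.of_nat m -> rv s 9 = T -> rv s 10 = y ->
  runs right_test s (fun t s' => (t <= 150 * (m - v + 1))%nat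
    /\ ((1 <= iv s' 26)%Z <-> right_ok P m T y)).
Proof.
  intros HP HD Hvm Hy H19 H25 H9 H10. unfold right_test. cbn [block].
  apply runs_seq, runs_iset, runs_seq, runs_iset, runs_seq, runs_rset, runs_seq. sim.
  eapply runs_impl.
  { apply runs_frame, (runs_scan_right P k _ v m y); auto; sim; lia. }
  intros t1 s1 [[Ht1 R1] [_ FR]]. apply runs_if. sim.
  rewrite (FR 9%nat) by reflexivity. sim. rewrite H9.
  destruct (Rle_dec (rv s1 5) T); apply runs_iset; sim;
    (split; [lia|]); rewrite (R1 T); split; intros; auto; lia || contradiction.
Qed.

Lemma runs_place_sink P k s T a v l :
  is_dynamic_path P -> holds_data P k s -> (a <= v <= l)%nat -> (l <= nedges P)%nat ->
  iv s 16 = Z.of_nat a -> iv s 19 = Z.of_nat v -> iv s 18 = Z.of_nat l -> rv s 9 = T ->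
  left_ok P a T (vpos P v) -> (v = l \/ ~ left_ok P a T (vpos P (S v))) ->
  runs place_sink s (fun t s' => (t <= 250 * (v - a + 1))%nat
    /\ left_ok P a T (rv s' 10)
    /\ ((v = l /\ rv s' 10 = vpos P v)
        \/ ((v < l)%nat /\ vpos P v <= rv s' 10 < vpos P (S v)
            /\ forall y', left_ok P a T y' -> y' <= rv s' 10))).
Proof.
  intros HP HD Hav Hl H16 H19 H18 H9 HL HN.
  pose proof HD as (_ & _ & _ & _ & D0 & D1).
  unfold place_sink. cbn [block].
  apply runs_seq, runs_rset, runs_if. sim. rewrite H18, H19.
  destruct (Z.leb_spec (Z.of_nat v + 1) (Z.of_nat l)) as [Hlt|Hge].
  - destruct HN as [HN|HN]; [lia|].
    cbn [block]. apply runs_seq, runs_iset, runs_seq, runs_iset, runs_seq. sim.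
    eapply runs_impl.
    { apply runs_frame, (runs_scan_left P k _ a (S v)); auto; sim; lia. }
    intros t1 s1 [[Ht1 R1] F].
    assert (D0' : rv s1 0 = tau P) by (rewrite (proj2 F) by reflexivity; sim; auto).
    assert (D1' : reals s1 1 (Z.of_nat (S v)) = vpos P (S v)).
    { rewrite (proj2 F) by reflexivity; sim. apply D1; lia. }
    assert (H19' : iv s1 19 = Z.of_nat v) by (rewrite (proj1 F) by reflexivity; sim; auto).
    assert (H9' : rv s1 9 = T) by (rewrite (proj2 F) by reflexivity; sim; auto).
    assert (H10' : rv s1 10 = vpos P v).
    { rewrite (proj2 F) by reflexivity; sim. rewrite D1 by lia; auto. }
    apply runs_seq, runs_rset. sim. apply runs_if. sim.
    rewrite H19'. replace (Z.of_nat v + 1)%Z with (Z.of_nat (S v)) by lia.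
    rewrite D0', D1', H9', H10'.
    pose proof (left_ok_rightmost P a v T _ HP ltac:(lia) HL HN R1) as HY.
    cbv zeta in HY. unfold Rmax in HY.
    destruct (Rle_dec (vpos P v) _) as [Hz|Hz];
      [apply runs_rset | apply runs_skip]; sim; rewrite ?H10';
      (split; [lia|]); destruct HY as (Y1 & Y2 & Y3); (split; [auto|]);
      right; (split; [lia|]); auto.
  - apply runs_skip. sim. rewrite D1 by lia. split; [lia|]. split; [auto|].
    left; split; [lia | auto].
Qed.

Lemma runs_next_part P k s T a l L :
  is_dynamic_path P -> holds_data P k s -> (a <= l <= nedges P)%nat ->
  (nedges P < 2 ^ L)%nat -> 0 <= T ->
  iv s 16 = Z.of_nat a -> iv s 18 = Z.of_nat l -> rv s 9 = T ->
  runs next_part s (fun t s' => exists b, iv s' 23 = Z.of_nat b /\ (a <= b <= l)%nat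
    /\ (t <= (100 * 40) * (L + 1) * (b - a + 1))%nat
    /\ vpos P a <= rv s' 10 <= vpos P b
    /\ left_ok P a T (rv s' 10) /\ right_ok P b T (rv s' 10)
    /\ forall b', (b < b' <= l)%nat -> ~ one_sink P a b' T).
Proof.
  intros HP HD Hal HL HT H16 H18 H9.
  unfold next_part. cbn [block]. apply runs_seq. eapply runs_impl.
  { apply runs_frame, (runs_gallop 16 18 19 20 21 22 left_test
      (fun m => left_ok P a T (vpos P m)) a l 150 L s); try reflexivity; auto; try lia.
    - repeat constructor; cbn; lia.
    - intros s1 m F1 Hm Hml. keep HD F1 HD1.
      apply (runs_left_test P k); auto; try lia.
      + rewrite (proj1 F1) by reflexivity; auto.
      + rewrite (proj2 F1) by reflexivity; auto. }
  intros t1 s1 [(v & H19 & Hv & HLv & HLv' & Ht1) F1].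
  keep HD F1 HD1.
  assert (G16 : iv s1 16 = Z.of_nat a) by (rewrite (proj1 F1) by reflexivity; auto).
  assert (G18 : iv s1 18 = Z.of_nat l) by (rewrite (proj1 F1) by reflexivity; auto).
  assert (G9 : rv s1 9 = T) by (rewrite (proj2 F1) by reflexivity; auto).
  assert (HLv2 : left_ok P a T (vpos P v)).
  { destruct HLv as [->|]; auto. apply left_ok_start; auto; lra. }
  apply runs_seq. eapply runs_impl.
  { apply runs_frame, (runs_place_sink P k s1 T a v l); auto; lia. }
  intros t2 s2 [(Ht2 & HLy & HY) F2]. keep HD1 F2 HD2.
  set (y := rv s2 10) in *.
  assert (Hyv : vpos P v <= y < vpos P (S v) \/ y = vpos P v) by tauto.
  assert (Q19 : iv s2 19 = Z.of_nat v) by (rewrite (proj1 F2) by reflexivity; auto).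
  assert (Q18 : iv s2 18 = Z.of_nat l) by (rewrite (proj1 F2) by reflexivity; auto).
  assert (Q9 : rv s2 9 = T) by (rewrite (proj2 F2) by reflexivity; auto).
  apply runs_seq. eapply runs_impl.
  { apply runs_frame, (runs_gallop 19 18 23 24 25 26 right_test
      (fun m => right_ok P m T y) v l 150 L s2); try reflexivity; auto; try lia.
    - repeat constructor; cbn; lia.
    - intros s3 m F3 Hm Hml. keep HD2 F3 HD3.
      apply (runs_right_test P k); auto; try lia.
      + rewrite (proj1 F3) by reflexivity; auto.
      + rewrite (proj2 F3) by reflexivity; auto.
      + rewrite (proj2 F3) by reflexivity; auto. }
  intros t3 s3 [(b & H23 & Hb & HRb & HRb' & Ht3) F3].
  keep HD2 F3 HD3.
  assert (P19 : iv s3 19 = Z.of_nat v) by (rewrite (proj1 F3) by reflexivity; auto).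
  assert (P10 : rv s3 10 = y) by (rewrite (proj2 F3) by reflexivity; auto).
  assert (Xav : vpos P a <= vpos P v) by (apply vpos_le; auto; lia).
  assert (Max : forall b', (b < b' <= l)%nat -> ~ one_sink P a b' T).
  (* A longer part restricts to one ending at [S b]. Its sink lies at or before [y], so [y] would
     serve its right side too, against the failed test. *)
  { intros b' Hb' HO. destruct HRb' as [->|HRb']; [lia|].
    apply (one_sink_sub P a b' a (S b)) in HO; auto; try lia.
    destruct HO as (y' & Hy' & HL' & HR'). apply HRb'.
    apply right_ok_ge_sink with y'; auto.
    destruct HY as [[-> _]|(_ & _ & HY)]; [lia | apply HY; auto]. }
  assert (Hcost : forall c, (c <= 40)%nat ->
    (t1 + (t2 + (t3 + c)) <= (100 * 40) * (L + 1) * (b - a + 1))%nat).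
  (* Each search covers at most the length of the part, at a test cost of [150] per vertex, so
     [2 * 150 + 100 = 400] per vertex and factor [2 * L + 3]. *)
  { intros c Hc. rewrite <- Nat.mul_assoc in Ht1, Ht3.
    assert ((2 * 150 + 100) * (v - a + 1) <= 400 * (b - a + 1))%nat by lia.
    assert ((2 * 150 + 100) * (b - v + 1) <= 400 * (b - a + 1))%nat by lia.
    assert (t1 <= (2 * L + 3) * (400 * (b - a + 1)))%nat
      by (eapply Nat.le_trans; [exact Ht1 | apply Nat.mul_le_mono_l; auto]).
    assert (t3 <= (2 * L + 3) * (400 * (b - a + 1)))%nat
      by (eapply Nat.le_trans; [exact Ht3 | apply Nat.mul_le_mono_l; auto]).
    assert (t2 <= 250 * (b - a + 1))%nat by lia.
    nia. }
  apply runs_if. sim. rewrite H23, P19.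
  destruct (Z.leb_spec (Z.of_nat b) (Z.of_nat v)) as [Hbv|Hbv].
  - assert (b = v) by lia. subst b.
    apply runs_rset. sim. rewrite P19.
    destruct HD3 as (_ & _ & _ & _ & _ & D1). rewrite D1 by lia.
    exists v. split; [auto|]. split; [lia|]. split; [apply Hcost; lia|].
    split; [lra|]. split; [auto|]. split; [|auto].
    apply right_ok_end; auto; [lia|lra].
  - apply runs_skip. exists b. split; [auto|]. split; [lia|]. split; [apply Hcost; lia|].
    rewrite P10. pose proof (vpos_le P (S v) b HP ltac:(lia)).
    split; [|split; [auto|split; [|auto]]].
    + destruct HY as [[-> _]|(_ & HY & _)]; [lia | lra].
    + destruct HRb as [->|]; [lia | auto].
Qed.

Definition decide : com :=
  block
    [iassign 16 (IConst 0); iassign 17 (IConst 0); ISet 4 (IConst 0) (IConst 0);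
     While (ILe (IAdd (V 17) (IConst 1)) (V 1))
       (block
         [iassign 17 (IAdd (V 17) (IConst 1));
          iassign 18 (ISub (V 0) (ISub (V 1) (V 17)));
          next_part;
          RSet 3 (V 17) (RV 10);
          iassign 16 (IAdd (V 23) (IConst 1));
          ISet 4 (V 17) (V 16)]);
     If (ILe (IAdd (V 0) (IConst 1)) (V 16)) (iassign 27 (IConst 1)) (iassign 27 (IConst 0))].

Definition stored_parts (P : path) (T : R) (j : nat) (s : store) : Prop :=
  ints s 4 0%Z = 0%Z /\
  forall h, (h < j)%nat -> exists a b,
    ints s 4 (Z.of_nat h) = Z.of_nat a /\ ints s 4 (Z.of_nat (S h)) = Z.of_nat (S b)
    /\ (a <= b <= nedges P)%nat
    /\ vpos P a <= reals s 3 (Z.of_nat (S h)) <= vpos P b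
    /\ left_ok P a T (reals s 3 (Z.of_nat (S h)))
    /\ right_ok P b T (reals s 3 (Z.of_nat (S h))).

(* Each part takes as many vertices as it can while leaving one for each of the
   remaining parts. *)
Lemma cov_greedy P T k j a b :
  is_dynamic_path P -> (S j <= k <= S (nedges P))%nat ->
  (a <= b <= nedges P - (k - S j))%nat ->
  (forall c, (c <= S (nedges P))%nat -> cov P T j c ->
     (Nat.min c (S (nedges P) - (k - j)) <= a)%nat) ->
  (forall b', (b < b' <= nedges P - (k - S j))%nat -> ~ one_sink P a b' T) ->
  forall c, (c <= S (nedges P))%nat -> cov P T (S j) c ->
  (Nat.min c (S (nedges P) - (k - S j)) <= S b)%nat.
Proof.
  intros HP Hj Hab IH Hmax c Hc (a0 & Ha0 & Hcov & Ho).
  (* The minimum cuts a covering off where the reserve of one vertex per remaining part begins;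
     after all [k] parts nothing is reserved. *)
  destruct (le_gt_dec (Nat.min c (S (nedges P) - (k - S j))) (S b)) as [|Hgt]; auto.
  exfalso. specialize (IH a0 ltac:(lia) Hcov).
  apply (Hmax (S b)); [lia|].
  apply (one_sink_sub P a0 (c - 1)); auto; try lia. apply Ho; lia.
Qed.

Lemma runs_decide P k s T L :
  is_dynamic_path P -> holds_data P k s -> (1 <= k <= S (nedges P))%nat ->
  (nedges P < 2 ^ L)%nat -> 0 <= T -> rv s 9 = T ->
  runs decide s (fun t s' => (t <= (100 * 50) * (L + 1) * S (nedges P))%nat
    /\ ((1 <= iv s' 27)%Z <-> cov P T k (S (nedges P)))
    /\ (cov P T k (S (nedges P)) ->
        stored_parts P T k s' /\ ints s' 4 (Z.of_nat k) = Z.of_nat (S (nedges P)))).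
Proof.
  intros HP HD Hk HL HT H9. unfold decide. cbn [block].
  apply runs_seq, runs_iset, runs_seq, runs_iset, runs_seq, runs_iset. sim.
  set (s0 := iset _ 4 _ _). apply runs_seq.
  assert (HD0 : holds_data P k s0) by exact HD.
  set (n := nedges P) in *.
  eapply runs_while with
    (Inv := fun t s => holds_data P k s /\ rv s 9 = T /\ exists j a,
        (j <= k)%nat /\ iv s 17 = Z.of_nat j /\ iv s 16 = Z.of_nat a
        /\ (a <= S n - (k - j))%nat
        (* A part [a .. b] costs in proportion to [S b - a], so the total time is charged to the
           current start. *)
        /\ ints s 4 (Z.of_nat j) = Z.of_nat a /\ (t <= (100 * 41) * (L + 1) * a)%nat
        /\ stored_parts P T j s /\ cov P T j a
        /\ forall c, (c <= S n)%nat -> cov P T j c -> (Nat.min c (S n - (k - j)) <= a)%nat)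
    (m := fun s => Z.to_nat (Z.of_nat k - iv s 17)).
  - split; [auto|]. split; [auto|]. exists 0%nat, 0%nat.
    repeat split; try lia; try reflexivity.
    cbn. intros; lia.
  - clear s HD H9 s0 HD0.
    intros t s (HD & H9 & j & a & Hj & H17 & H16 & Ha & H4 & Ht & [Hz Hs] & Hc & Hg) Hb.
    cbn in Hb. pose proof HD as (D0 & D1 & _). rewrite H17, D1 in Hb.
    apply Z.leb_le in Hb.
    cbn [block]. apply runs_seq, runs_iset, runs_seq, runs_iset, runs_seq. sim.
    rewrite H17, D0, D1.
    set (s1 := iset _ 18 _ _).
    set (l := (n - (k - S j))%nat).
    eapply runs_impl.
    { apply runs_frame, (runs_next_part P k s1 T a l L); auto; try lia.
      unfold s1; sim. fold n. lia. }
    intros t1 s2 [(b & H23 & Hb' & Ht1 & Hy & HLy & HRy & Hmax) F2].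
    assert (HD1 : holds_data P k s1) by exact HD.
    keep HD1 F2 HD2.
    assert (Q17 : iv s2 17 = Z.of_nat (S j)).
    { rewrite (proj1 F2) by reflexivity. unfold s1; sim. lia. }
    assert (Q9 : rv s2 9 = T) by (rewrite (proj2 F2) by reflexivity; auto).
    assert (Q4 : forall z, ints s2 4 z = ints s 4 z).
    { intros z. rewrite (proj1 F2) by reflexivity. reflexivity. }
    assert (Q3 : forall z, reals s2 3 z = reals s 3 z).
    { intros z. rewrite (proj2 F2) by reflexivity. reflexivity. }
    clearbody s1.
    apply runs_seq, runs_rset, runs_seq, runs_iset, runs_iset. sim.
    rewrite Q17, H23. replace (Z.of_nat b + 1)%Z with (Z.of_nat (S b)) by lia.
    split; [|lia].
    split; [exact HD2|]. split; [auto|].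
    exists (S j), (S b).
    split; [lia|]. split; [auto|]. split; [auto|]. split; [lia|].
    unfold update. cbn [Nat.eqb andb]. rewrite Z.eqb_refl.
    split; [auto|]. split; [nia|].
    split; [|split].
    + unfold stored_parts. cbn [ints reals iset rset]. unfold update. cbn [Nat.eqb andb]. split.
      { destruct (Z.eqb_spec 0 (Z.of_nat (S j))); [lia|]. rewrite Q4; auto. }
      intros h Hh. destruct (Nat.eq_dec h j) as [->|].
      * exists a, b. rewrite !Z.eqb_refl.
        destruct (Z.eqb_spec (Z.of_nat j) (Z.of_nat (S j))); [lia|].
        rewrite Q4. repeat split; auto; try lia; try lra; try apply HLy; try apply HRy.
      * destruct (Hs h ltac:(lia)) as (a' & b' & E).
        exists a', b'.
        destruct (Z.eqb_spec (Z.of_nat h) (Z.of_nat (S j))); [lia|].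
        destruct (Z.eqb_spec (Z.of_nat (S h)) (Z.of_nat (S j))); [lia|].
        rewrite !Q4, !Q3. auto.
    + exists a. split; [lia|]. split; [auto|]. intros _.
      replace (S b - 1)%nat with b by lia. exists (rv s2 10); auto.
    + apply cov_greedy with a; auto; lia.
  - clear s HD H9 s0 HD0.
    intros t s (HD & H9 & j & a & Hj & H17 & H16 & Ha & H4 & Ht & Hs & Hc & Hg) Hb.
    cbn in Hb. pose proof HD as (D0 & D1 & _). rewrite H17, D1 in Hb.
    apply Z.leb_gt in Hb. assert (j = k) by lia. subst j.
    assert (Ea : cov P T k (S n) <-> a = S n).
    { split; [|intros <-; auto]. intros H. specialize (Hg (S n) (le_n _) H). lia. }
    apply runs_if. sim. rewrite D0, H16. fold n.
    destruct (Z.leb_spec (Z.of_nat n + 1) (Z.of_nat a)) as [H|H];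
      apply runs_iset; sim; (split; [nia|]); rewrite Ea; (split; [lia|]).
    + intros ->. split; auto.
    + intros; lia.
Qed.

(** * Parametric search *)

Definition prefix_sums : com :=
  block
    [iassign 28 (IConst 0);
     While (ILe (V 28) (V 0))
       (block
         [ISet 5 (IAdd (V 28) (IConst 1)) (IAdd (IGet 5 (V 28)) (IGet 2 (V 28)));
          iassign 28 (IAdd (V 28) (IConst 1))])].

Lemma array_in {A : Type} (zero : A) f lo hi j :
  (lo <= j <= hi)%nat -> array zero f lo hi (Z.of_nat j) = f j.
Proof.
  intros H. unfold array.
  destruct (Z.leb_spec (Z.of_nat lo) (Z.of_nat j)); [|lia].
  destruct (Z.leb_spec (Z.of_nat j) (Z.of_nat hi)); [|lia].
  cbn [andb]. rewrite Nat2Z.id. reflexivity.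
Qed.

Lemma runs_prefix_sums P k :
  runs prefix_sums (input P k) (fun t s =>
    (t <= 60 * S (nedges P))%nat /\ holds_data P k s).
Proof.
  unfold prefix_sums. cbn [block]. apply runs_seq, runs_iset.
  set (s0 := iset _ 28 _ _).
  assert (F0 : frame [5; 28]%nat [] (input P k) s0) by (unfold s0; framed).
  eapply runs_while with
    (Inv := fun t s => frame [5; 28]%nat [] (input P k) s /\ exists j,
        (j <= S (nedges P))%nat /\ iv s 28 = Z.of_nat j /\ (t <= 30 * j)%nat
        /\ forall h, (h <= j)%nat -> ints s 5 (Z.of_nat h) = Z.of_nat (psum P h))
    (m := fun s => Z.to_nat (Z.of_nat (nedges P) + 1 - iv s 28)).
  - split; [auto|]. exists 0%nat. repeat split; try lia.
    intros h Hh. replace h with 0%nat by lia. reflexivity.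
  - clear s0 F0. intros t s (F & j & Hj & H28 & Ht & H5) Hb.
    cbn in Hb. rewrite (proj1 F 0%nat), H28 in Hb by reflexivity.
    cbn [ints input] in Hb. change 0%Z with (Z.of_nat 0) in Hb.
    rewrite array_in in Hb by lia. apply Z.leb_le in Hb.
    assert (H2 : ints s 2 (Z.of_nat j) = Z.of_nat (weight P j)).
    { rewrite (proj1 F) by reflexivity. cbn [ints input]. rewrite array_in by lia. auto. }
    cbn [block]. apply runs_seq, runs_iset, runs_iset. sim.
    rewrite H28, H2, H5 by lia.
    replace (Z.of_nat j + 1)%Z with (Z.of_nat (S j)) by lia.
    split; [|lia]. split; [eapply frame_trans; [exact F | framed]|].
    exists (S j). split; [lia|]. split; [auto|]. split; [lia|].
    intros h Hh. unfold update. cbn [Nat.eqb andb].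
    destruct (Z.eqb_spec (Z.of_nat h) (Z.of_nat (S j))) as [E|E].
    + replace h with (S j) by lia. rewrite psum_S. lia.
    + apply H5; lia.
  - clear s0 F0. intros t s (F & j & Hj & H28 & Ht & H5) Hb.
    cbn in Hb. rewrite (proj1 F 0%nat), H28 in Hb by reflexivity.
    cbn [ints input] in Hb. change 0%Z with (Z.of_nat 0) in Hb.
    rewrite array_in in Hb by lia. apply Z.leb_gt in Hb. sim.
    split; [lia|].
    unfold holds_data.
    rewrite !(proj1 F 0%nat), !(proj1 F 1%nat), !(proj2 F 0%nat) by reflexivity.
    cbn [ints reals input]. change 0%Z with (Z.of_nat 0).
    rewrite !array_in by lia.
    split; [auto|]. split; [auto|]. split; [|split; [|split]]; auto.
    + intros i Hi. rewrite (proj1 F) by reflexivity. cbn [ints input].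
      rewrite array_in by lia. auto.
    + intros h Hh. apply H5; lia.
    + intros i Hi. rewrite (proj2 F) by reflexivity. cbn [reals input].
      rewrite array_in by lia. auto.
Qed.

(* Here [32] and [33] are the far end and the midpoint of the search, so the
   test succeeds when the value of the part [29 .. 33] is infeasible. *)
Definition infeasible_test : com :=
  block
    [iassign 10 (V 29); iassign 11 (V 33); eval_one_sink; rassign 9 (RV 8); decide;
     If (ILe (IConst 1) (V 27)) (iassign 34 (IConst 0)) (iassign 34 (IConst 1))].

Definition stage : com :=
  block
    [iassign 31 (ISub (V 29) (IConst 1)); iassign 32 (V 0);
     bsearch 31 32 33 34 infeasible_test;
     iassign 10 (V 29); iassign 11 (V 32); eval_one_sink;
     If (RLe (RV 8) (RV 2)) (rassign 2 (RV 8)) Skip;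
     iassign 29 (V 32); iassign 30 (IAdd (V 30) (IConst 1))].

(** The first candidate is the one-sink value of the whole path. Decisions made during the search
    overwrite the stored protocol, so the final call rebuilds the one for the best bound. *)
Definition k_sink : com :=
  block
    [prefix_sums;
     iassign 10 (IConst 0); iassign 11 (V 0); eval_one_sink; rassign 2 (RV 8);
     iassign 29 (IConst 0); iassign 30 (IConst 0);
     While (ILe (IAdd (V 30) (IConst 1)) (V 1)) stage;
     rassign 9 (RV 2);
     decide].

Lemma runs_infeasible_test P k s a b L :
  is_dynamic_path P -> holds_data P k s -> (1 <= k <= S (nedges P))%nat ->
  (a <= b <= nedges P)%nat -> (S (nedges P) <= 2 ^ L)%nat ->
  iv s 29 = Z.of_nat a -> iv s 33 = Z.of_nat b ->
  runs infeasible_test s (fun t s' => (t <= (100 * 70) * (L + 1) * S (nedges P))%nat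
    /\ ((1 <= iv s' 34)%Z <->
        exists T, is_ray (one_sink P a b) T /\ ~ cov P T k (S (nedges P)))).
Proof.
  intros HP HD Hk Hab HL H29 H33. unfold infeasible_test. cbn [block].
  apply runs_seq, runs_iset, runs_seq, runs_iset, runs_seq. sim.
  set (s0 := iset _ 11 _ _). assert (HD0 : holds_data P k s0) by exact HD.
  eapply runs_impl.
  { apply runs_frame, (runs_eval_one_sink P k s0 a b L); auto. }
  intros t1 s1 [(Ht1 & R1) F1]. keep HD0 F1 HD1.
  apply runs_seq, runs_rset. sim. set (s2 := rset _ 9 _ _).
  assert (HD2 : holds_data P k s2) by exact HD1.
  assert (T0 : 0 <= rv s1 8) by (apply one_sink_nonneg with P a b, R1; lra).
  apply runs_seq. eapply runs_impl.
  { apply (runs_decide P k s2 (rv s1 8) L); auto. }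
  intros t3 s3 (Ht3 & Hdec & _).
  assert (E : (exists T, is_ray (one_sink P a b) T /\ ~ cov P T k (S (nedges P)))
              <-> ~ (1 <= iv s3 27)%Z).
  { rewrite Hdec. split.
    - intros (T & HT & HN). rewrite (is_ray_unique _ _ _ R1 HT). auto.
    - intros HN. exists (rv s1 8); auto. }
  apply runs_if. sim.
  destruct (Z.leb_spec 1 (iv s3 27)) as [H|H]; apply runs_iset; sim;
    (split; [nia|]); rewrite E; lia.
Qed.

(* [T < best] can reach no further with [j] parts than the current start [a], so
   the final start being a vertex shows that [best] is optimal.  Conversely [a]
   is reached within some infeasible time, which makes the part from [a] to the
   end feasible. *)
Definition stage_inv (P : path) (k j a : nat) (best : R) : Prop :=
  (a <= nedges P)%nat /\ cov P best k (S (nedges P))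
  /\ (forall T c, (c <= S (nedges P))%nat -> T < best -> cov P T j c -> (c <= a)%nat)
  /\ exists T, cov P T j a /\ ~ cov P T k (S (nedges P)).

(** The larger time covers both stretches, and being one of the two it is still infeasible. *)
Lemma cov_max P k j a b T T1 :
  (S j <= k)%nat -> (a <= b)%nat -> cov P T j a -> ~ cov P T k (S (nedges P)) ->
  one_sink P a b T1 -> ~ cov P T1 k (S (nedges P)) ->
  cov P (Rmax T T1) (S j) (S b) /\ ~ cov P (Rmax T T1) k (S (nedges P)).
Proof.
  intros Hj Hab Hc HN HO HN1. split.
  - exists a. split; [lia|]. split.
    + apply cov_le_time with T; auto. apply Rmax_l.
    + intros _. replace (S b - 1)%nat with b by lia.
      apply one_sink_le_time with T1; auto. apply Rmax_r.
  - unfold Rmax. destruct (Rle_dec T T1); auto.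
Qed.

Lemma stage_inv_step P k j a b T1 best :
  is_dynamic_path P -> (S j <= k)%nat -> (a <= b <= nedges P)%nat ->
  stage_inv P k j a best ->
  is_ray (one_sink P a b) T1 ->
  (b = nedges P \/ cov P T1 k (S (nedges P))) ->
  (a < b -> exists T, is_ray (one_sink P a (b - 1)) T /\ ~ cov P T k (S (nedges P)))%nat ->
  stage_inv P k (S j) b (Rmin T1 best).
Proof.
  intros HP Hj Hab (Ha & Hbest & Hlt & T' & HT' & HN') HT1 Hb Hpred.
  assert (HO1 : one_sink P a b T1) by (apply HT1; lra).
  assert (HC : cov P T1 k (S (nedges P))).
  { destruct Hb as [->|]; auto. apply NNPP; intros HN.
    destruct (cov_max P k j a (nedges P) T' T1) as [H1 H2]; auto; try lia.
    apply H2, cov_pad with (S j); auto. }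
  split; [lia|]. split; [|split].
  - unfold Rmin. destruct (Rle_dec T1 best); auto.
  - intros T c Hc HT (c0 & Hc0 & Hcov & Ho).
    assert (T < T1) by (pose proof (Rmin_l T1 best); lra).
    assert (T < best) by (pose proof (Rmin_r T1 best); lra).
    pose proof (Hlt T c0 ltac:(lia) ltac:(lra) Hcov).
    (* The last part starts at [c0 <= a]; ending beyond [b] it would contain [a .. b], which takes
       at least [T1]. *)
    destruct (le_gt_dec c b) as [|Hgt]; auto. exfalso.
    assert (T1 <= T); [|lra]. apply HT1.
    apply (one_sink_sub P c0 (c - 1)); auto; try lia. apply Ho; lia.
  - destruct (Nat.eq_dec a b) as [->|Hne].
    + exists T'. split; auto. apply cov_pad with j; auto.
    + destruct (Hpred ltac:(lia)) as (T2 & HT2 & HN2).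
      assert (HO2 : one_sink P a (b - 1) T2) by (apply HT2; lra).
      exists (Rmax T' T2). replace b with (S (b - 1)) by lia.
      apply cov_max with a; auto; lia.
Qed.

Lemma runs_stage P k s j a L :
  is_dynamic_path P -> holds_data P k s -> (S j <= k <= S (nedges P))%nat ->
  (S (nedges P) <= 2 ^ L)%nat ->
  iv s 29 = Z.of_nat a -> iv s 30 = Z.of_nat j -> stage_inv P k j a (rv s 2) ->
  runs stage s (fun t s' => (t <= (100 * 100) * (L + 1) * (L + 1) * S (nedges P))%nat
    /\ holds_data P k s' /\ iv s' 30 = Z.of_nat (S j)
    /\ exists b, iv s' 29 = Z.of_nat b /\ stage_inv P k (S j) b (rv s' 2)).
Proof.
  intros HP HD Hj HL H29 H30 Hinv. pose proof Hinv as (Ha & _).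
  pose proof HD as (D0 & _).
  unfold stage. cbn [block]. apply runs_seq, runs_iset, runs_seq, runs_iset. sim.
  rewrite H29, D0.
  set (s0 := iset _ 32 _ _). assert (HD0 : holds_data P k s0) by exact HD.
  set (Pr z := exists T, is_ray (one_sink P a (Z.to_nat z)) T
                         /\ ~ cov P T k (S (nedges P))).
  apply runs_seq. eapply runs_impl.
  { apply (runs_bsearch 31 32 33 34 infeasible_test Pr (Z.of_nat a - 1)
             (Z.of_nat (nedges P)) ((100 * 70) * (L + 1) * S (nedges P)) L s0);
      try reflexivity; try discriminate.
    - apply inj_le in HL. rewrite Nat2Z.inj_pow in HL. lia.
    - intros s1 F1 Hmid. keep HD0 F1 HD1.
      apply (runs_infeasible_test P k s1 a (Z.to_nat (iv s1 33)) L); auto; try lia.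
      rewrite (proj1 F1) by reflexivity. auto. }
  intros t1 s1 (Ht1 & F1 & x & E31 & E32 & Hx & HPx & HPx').
  keep HD0 F1 HD1.
  assert (G29 : iv s1 29 = Z.of_nat a) by (rewrite (proj1 F1) by reflexivity; auto).
  assert (G30 : iv s1 30 = Z.of_nat j) by (rewrite (proj1 F1) by reflexivity; auto).
  assert (G2 : rv s1 2 = rv s 2) by (rewrite (proj2 F1) by reflexivity; auto).
  set (b := Z.to_nat (x + 1)). replace (x + 1)%Z with (Z.of_nat b) in * by lia.
  apply runs_seq, runs_iset, runs_seq, runs_iset. sim. rewrite G29, E32.
  set (s2 := iset _ 11 _ _). assert (HD2 : holds_data P k s2) by exact HD1.
  apply runs_seq. eapply runs_impl.
  { apply runs_frame, (runs_eval_one_sink P k s2 a b L); auto; lia. }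
  intros t3 s3 [(Ht3 & R3) F3]. keep HD2 F3 HD3.
  assert (Hnext : stage_inv P k (S j) b (Rmin (rv s3 8) (rv s 2))).
  { apply stage_inv_step with a; auto; try lia.
    - destruct HPx' as [E|HN]; [left; lia|right].
      apply NNPP; intros HN'. apply HN. exists (rv s3 8). rewrite Nat2Z.id. auto.
    - intros Hlt. destruct HPx as [->|HPx]; [lia|].
      replace (b - 1)%nat with (Z.to_nat x) by lia. exact HPx. }
  assert (K29 : iv s3 32 = Z.of_nat b) by (rewrite (proj1 F3) by reflexivity; auto).
  assert (K30 : iv s3 30 = Z.of_nat j) by (rewrite (proj1 F3) by reflexivity; auto).
  assert (K2 : rv s3 2 = rv s 2) by (rewrite (proj2 F3) by reflexivity; auto).
  assert (Hcost : forall c, (c <= 100)%nat ->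
    (t1 + t3 + c <= (100 * 100) * (L + 1) * (L + 1) * S (nedges P))%nat) by (intros; nia).
  apply runs_seq, runs_if. sim. rewrite K2. unfold Rmin in Hnext.
  destruct (Rle_dec (rv s3 8) (rv s 2)) as [Hle|Hle].
  - apply runs_rset, runs_seq, runs_iset, runs_iset. sim. rewrite K29, K30.
    split; [specialize (Hcost 100%nat); lia|]. split; [exact HD3|]. split; [lia|].
    exists b; auto.
  - apply runs_skip, runs_seq, runs_iset, runs_iset. sim. rewrite K29, K30, K2.
    split; [specialize (Hcost 100%nat); lia|]. split; [exact HD3|]. split; [lia|].
    exists b; auto.
Qed.

Lemma runs_k_sink P k L :
  is_dynamic_path P -> (1 <= k <= S (nedges P))%nat -> (S (nedges P) <= 2 ^ L)%nat ->
  runs k_sink (input P k) (fun t s =>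
    (t <= (100 * 200) * k * S (nedges P) * ((L + 1) * (L + 1)))%nat
    /\ (forall T, cov P T k (S (nedges P)) -> rv s 2 <= T)
    /\ stored_parts P (rv s 2) k s
    /\ ints s 4 (Z.of_nat k) = Z.of_nat (S (nedges P))).
Proof.
  intros HP Hk HL. unfold k_sink. cbn [block].
  set (n := nedges P) in *.
  apply runs_seq. eapply runs_impl; [apply runs_prefix_sums|].
  intros t0 s0 [Ht0 HD0]. pose proof HD0 as (D0 & _).
  apply runs_seq, runs_iset, runs_seq, runs_iset. sim. rewrite D0.
  set (s1 := iset _ 11 _ _). assert (HD1 : holds_data P k s1) by exact HD0.
  apply runs_seq. eapply runs_impl.
  { apply runs_frame, (runs_eval_one_sink P k s1 0 n L); auto. unfold n; lia. }
  intros t2 s2 [(Ht2 & R2) F2]. keep HD1 F2 HD2.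
  apply runs_seq, runs_rset, runs_seq, runs_iset, runs_seq, runs_iset. sim.
  set (s3 := iset _ 30 _ _). assert (HD3 : holds_data P k s3) by exact HD2.
  assert (Hinit : stage_inv P k 0 0 (rv s2 8)).
  { split; [lia|]. split; [|split].
    - apply cov_pad with 1%nat; [lia|]. exists 0%nat. split; [lia|]. split; [reflexivity|].
      intros _. replace (S (nedges P) - 1)%nat with n by (unfold n; lia). apply R2; lra.
    - cbn; intros; lia.
    - exists (-1). split; [reflexivity|]. intros H. apply cov_nonneg in H; [lra | lia]. }
  apply runs_seq.
  eapply runs_while with
    (Inv := fun t s => holds_data P k s /\ exists j a, (j <= k)%nat
       /\ iv s 30 = Z.of_nat j /\ iv s 29 = Z.of_nat a /\ stage_inv P k j a (rv s 2)
       /\ (t <= j * ((100 * 101) * (L + 1) * (L + 1) * S n))%nat)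
    (m := fun s => Z.to_nat (Z.of_nat k - iv s 30)).
  - split; [exact HD3|]. exists 0%nat, 0%nat. repeat split; auto; try lia; apply Hinit.
  - clear - HP Hk HL.
    intros t s (HD & j & a & Hj & H30 & H29 & Hinv & Ht) Hb.
    cbn in Hb. pose proof HD as (_ & D1 & _). rewrite D1, H30 in Hb. apply Z.leb_le in Hb.
    eapply runs_impl; [apply (runs_stage P k s j a L); auto; lia|].
    intros t1 s1 (Ht1 & HD1 & K30 & b & K29 & Hinv1).
    split; [|lia]. split; [auto|]. exists (S j), b.
    split; [lia|]. split; [auto|]. split; [auto|]. split; [auto|]. sim.
    fold n in Ht1. nia.
  - clear s3 HD3.
    intros t s (HD & j & a & Hj & H30 & H29 & Hinv & Ht) Hb.
    cbn in Hb. pose proof HD as (_ & D1 & _). rewrite D1, H30 in Hb. apply Z.leb_gt in Hb.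
    assert (j = k) by lia. subst j.
    destruct Hinv as (Ha & Hbest & Hlt & _). fold n in Ha, Hbest, Hlt.
    assert (T0 : 0 <= rv s 2) by (apply cov_nonneg in Hbest; auto; lia).
    apply runs_seq, runs_rset. sim.
    eapply runs_impl.
    { apply runs_frame, (runs_decide P k _ (rv s 2) L); auto; fold n; lia. }
    intros t4 s4 [(Ht4 & _ & Hout) F4].
    assert (E2 : rv s4 2 = rv s 2) by (rewrite (proj2 F4) by reflexivity; auto).
    rewrite E2. fold n in Hout, Ht4. split; [|split].
    + clear - Ht Ht0 Ht2 Ht4 Hk. fold n in Ht0, Ht2.
      assert (1 * ((100 * 50) * (L + 1) * S n) <= k * ((100 * 50) * (L + 1) * S n))%nat
        by (apply Nat.mul_le_mono_r; lia).
      assert (1 * ((100 * 10) * (L + 1) * S n) <= k * ((100 * 10) * (L + 1) * S n))%nat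
        by (apply Nat.mul_le_mono_r; lia).
      assert (1 * (60 * S n) <= k * (60 * S n))%nat by (apply Nat.mul_le_mono_r; lia).
      cbn [bcost icost V].
      transitivity (k * ((100 * 101) * (L + 1) * (L + 1) * S n + (100 * 50) * (L + 1) * S n
                         + (100 * 10) * (L + 1) * S n + 60 * S n + 60))%nat; [lia|].
      replace ((100 * 200) * k * S n * ((L + 1) * (L + 1)))%nat
        with (k * ((100 * 200) * (S n * ((L + 1) * (L + 1)))))%nat by ring.
      apply Nat.mul_le_mono_l. nia.
    + intros T HT. destruct (Rle_lt_dec (rv s 2) T) as [|Hlt']; auto.
      specialize (Hlt T (S n) (le_n _) Hlt' HT). lia.
    + apply Hout, Hbest.
Qed.

(** * The theorem *)

Lemma finite_choice (Q : nat -> R -> Prop) (k : nat) :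
  (forall j, (1 <= j <= k)%nat -> exists t, Q j t) ->
  exists f, forall j, (1 <= j <= k)%nat -> Q j (f j).
Proof.
  induction k as [|k IH]; intros H.
  - exists (fun _ => 0); lia.
  - destruct IH as [f Hf]; [intros; apply H; lia|].
    destruct (H (S k)) as [t Ht]; [lia|].
    exists (fun j => if (j =? S k)%nat then t else f j). intros j Hj.
    destruct (Nat.eqb_spec j (S k)) as [->|]; [auto | apply Hf; lia].
Qed.

Lemma finite_max (f : nat -> R) (k : nat) :
  (1 <= k)%nat ->
  exists j, (1 <= j <= k)%nat /\ forall h, (1 <= h <= k)%nat -> f h <= f j.
Proof.
  induction 1 as [|k Hk (j & Hj & Hmax)].
  - exists 1%nat; split; [lia|]. intros h Hh. replace h with 1%nat by lia. lra.
  - destruct (Rle_lt_dec (f (S k)) (f j)).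
    + exists j; split; [lia|]. intros h Hh.
      destruct (Nat.eq_dec h (S k)) as [->|]; [auto | apply Hmax; lia].
    + exists (S k); split; [lia|]. intros h Hh.
      destruct (Nat.eq_dec h (S k)) as [->|]; [lra|].
      specialize (Hmax h ltac:(lia)). lra.
Qed.

Lemma strict_steps_le (i : nat -> nat) (k : nat) :
  (forall j, (j < k)%nat -> (i j < i (S j))%nat) ->
  forall j, (j <= k)%nat -> (i j <= i k)%nat.
Proof.
  intros H j Hj. induction Hj as [|k Hj IH]; [lia|].
  specialize (IH ltac:(intros; apply H; lia)). specialize (H k ltac:(lia)). lia.
Qed.

Lemma protocol_cov P k i y T :
  is_dynamic_path P -> is_protocol P k i y -> is_protocol_time P k i y T ->
  cov P T k (nvertices P).
Proof.
  intros HP (E0 & Ek & Hinc & Hy) (theta & Hth & _ & Hle).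
  pose proof (strict_steps_le i k Hinc) as Hmon. rewrite Ek in Hmon.
  rewrite <- Ek.
  enough (G : forall j, (j <= k)%nat -> cov P T j (i j)) by (apply G; lia).
  induction j as [|j IH]; intros Hj; [exact E0|].
  pose proof (Hinc j ltac:(lia)) as Hlt. pose proof (Hmon (S j) Hj) as Hn.
  unfold nvertices in Hn.
  exists (i j). split; [lia|]. split; [apply IH; lia|]. intros _.
  specialize (Hy (S j) ltac:(lia)). specialize (Hth (S j) ltac:(lia)).
  unfold part in Hy, Hth. replace (S j - 1)%nat with j in * by lia.
  cbn [subpath vpos nedges] in Hy. rewrite Nat.add_0_r in Hy.
  replace (i j + (i (S j) - 1 - i j))%nat with (i (S j) - 1)%nat in Hy by lia.
  apply is_Theta_one_sink with (y (S j)) (theta (S j)); auto; try lia.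
  apply Hle; lia.
Qed.

(** The stored sinks only certify [T] as a bound, so the actual time [T'] might be smaller;
    minimality of [T] excludes this in the end. *)
Lemma stored_parts_protocol P T k s :
  is_dynamic_path P -> (1 <= k)%nat -> stored_parts P T k s ->
  ints s 4 (Z.of_nat k) = Z.of_nat (nvertices P) ->
  let i j := Z.to_nat (ints s 4 (Z.of_nat j)) in
  let y j := reals s 3 (Z.of_nat j) in
  is_protocol P k i y
  /\ (forall j, (j <= k)%nat -> ints s 4 (Z.of_nat j) = Z.of_nat (i j))
  /\ exists T', T' <= T /\ is_protocol_time P k i y T'.
Proof.
  intros HP Hk [H0 Hs] Ek i y.
  assert (Hpart : forall j, (1 <= j <= k)%nat -> exists a b,
    part P i j = subpath P a b /\ i (j - 1)%nat = a /\ i j = S b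
    /\ (a <= b <= nedges P)%nat /\ vpos P a <= y j <= vpos P b
    /\ left_ok P a T (y j) /\ right_ok P b T (y j)).
  { intros j Hj. destruct (Hs (j - 1)%nat ltac:(lia)) as (a & b & E1 & E2 & Hrest).
    replace (S (j - 1)) with j in * by lia.
    assert (I1 : i (j - 1)%nat = a) by (unfold i; rewrite E1, Nat2Z.id; auto).
    assert (I2 : i j = S b) by (unfold i; rewrite E2, Nat2Z.id; auto).
    exists a, b. split; [|auto].
    unfold part. rewrite I1, I2. f_equal. lia. }
  split; [|split].
  - split; [|split; [|split]].
    + unfold i. cbn [Z.of_nat]. rewrite H0. reflexivity.
    + unfold i. rewrite Ek, Nat2Z.id. reflexivity.
    + intros j Hj. destruct (Hpart (S j) ltac:(lia)) as (a & b & _ & E1 & E2 & Hab & _).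
      replace (S j - 1)%nat with j in E1 by lia. lia.
    + intros j Hj. destruct (Hpart j Hj) as (a & b & -> & _ & _ & Hab & Hy & _).
      cbn [subpath vpos nedges]. rewrite Nat.add_0_r.
      replace (a + (b - a))%nat with b by lia. auto.
  - intros [|j] Hj; unfold i.
    + cbn [Z.of_nat]. rewrite H0. reflexivity.
    + destruct (Hs j ltac:(lia)) as (a & b & _ & E & _). rewrite E, Nat2Z.id. auto.
  - destruct (finite_choice (fun j t => is_Theta (part P i j) (y j) t /\ t <= T) k)
      as [theta Hth].
    { intros j Hj. destruct (Hpart j Hj) as (a & b & -> & _ & _ & Hab & Hy & HL & HR).
      apply is_Theta_exists; auto. }
    destruct (finite_max theta k Hk) as (j & Hj & Hmax).
    exists (theta j). split; [apply Hth; auto|].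
    exists theta. split; [intros; apply Hth; auto|]. split; [exists j; auto | auto].
Qed.

(** Since [ln 2 > 1 / 2], the rounded logarithm is at most [2 * ln N + 1]. The remaining constant
    [2] is at most [4 * ln N] because [N] is at least [2], whence the [6]. *)
Lemma log2_up_le_ln (N : nat) :
  (2 <= N)%nat -> INR (Nat.log2_up N + 1) <= 6 * ln (INR N).
Proof.
  intros HN.
  assert (H2 : 2 <= INR N) by (apply (le_INR 2); auto).
  assert (L2 : ln 2 <= ln (INR N)).
  { destruct H2 as [H2|<-]; [left; apply ln_increasing; lra | lra]. }
  pose proof ln_lt_2 as Hl2.
  assert (HL : INR (Nat.log2_up N - 1) * ln 2 <= ln (INR N)).
  { rewrite <- ln_pow by lra. left. apply ln_increasing; [apply pow_lt; lra|].
    rewrite <- (pow_INR 2). apply lt_INR.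
    pose proof (Nat.log2_up_spec N ltac:(lia)) as [H _].
    rewrite Nat.sub_1_r. auto. }
  assert (1 <= Nat.log2_up N)%nat by (apply (Nat.log2_up_le_mono 2 N); lia).
  rewrite minus_INR in HL by auto. cbn [INR] in HL.
  rewrite plus_INR. cbn [INR].
  assert (0 <= INR (Nat.log2_up N) - 1).
  { pose proof (le_INR 1 _ H) as H1. cbn [INR] in H1. lra. }
  nra.
Qed.

Theorem theorem4 :
  exists (algo : com) (C : R),
    forall (P : path) (k : nat),
      is_dynamic_path P -> (1 <= k <= nvertices P)%nat ->
      exists (t : nat) (s : store),
        exec algo (input P k) t s
        /\ ((2 <= nvertices P)%nat ->
            INR t <= C * (INR k * INR (nvertices P) * (ln (INR (nvertices P))) ^ 2))
        /\ exists (T : R) (i : nat -> nat) (y : nat -> R),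
             is_output s k T i y
             /\ is_Theta_k P k T
             /\ is_protocol P k i y
             /\ is_protocol_time P k i y T.
Proof.
  (* [100 * 200] is the constant of [runs_k_sink], and [36] the square of the [6] in
     [log2_up_le_ln]. *)
  exists k_sink, (100 * 200 * 36). intros P k HP Hk.
  assert (HL : (S (nedges P) <= 2 ^ Nat.log2_up (nvertices P))%nat).
  { apply Nat.log2_log2_up_spec. unfold nvertices. lia. }
  destruct (runs_k_sink P k _ HP Hk HL) as (t & s & Hex & Ht & Hmin & Hst & Hend).
  exists t, s. split; [auto|]. split.
  - intros HN. pose proof (log2_up_le_ln _ HN) as Hlog.
    change (S (nedges P)) with (nvertices P) in Ht.
    set (N := nvertices P) in *. set (L := Nat.log2_up N) in *.
    apply le_INR in Ht. rewrite !mult_INR in Ht.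
    eapply Rle_trans; [exact Ht|].
    pose proof (pos_INR k). pose proof (pos_INR N). pose proof (pos_INR (L + 1)).
    replace (INR 100) with 100 by (cbn; lra). replace (INR 200) with 200 by (cbn; lra).
    assert (Hsq : INR (L + 1) * INR (L + 1) <= 36 * ln (INR N) ^ 2) by nra.
    replace (100 * 200 * 36 * (INR k * INR N * ln (INR N) ^ 2))
      with (100 * 200 * INR k * INR N * (36 * ln (INR N) ^ 2)) by ring.
    apply Rmult_le_compat_l; [|auto].
    repeat apply Rmult_le_pos; lra.
  - destruct (stored_parts_protocol P (reals s 2 0%Z) k s HP ltac:(lia) Hst Hend)
      as (Hprot & Hi & T' & HT' & Htime).
    assert (E : T' = reals s 2 0%Z).
    { apply Rle_antisym; auto. apply Hmin. eapply protocol_cov; eauto. }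
    subst T'.
    do 3 eexists. split; [|split; [|split; [exact Hprot | exact Htime]]].
    + split; [reflexivity | split; [exact Hi | reflexivity]].
    + split; [eauto|]. intros T'' (i & y & Hp & Ht').
      apply Hmin. eapply protocol_cov; eauto.
Qed.
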